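(* Let $0<\lambda<1$, $0<\alpha\le 1$, $D=[0,2\pi]^2$, and let $\Psi=H_{\alpha\alpha}(D)$ be the class of functions $f$ on $D$ with $|f(x_1,x_2)-f(y_1,y_2)|\le |x_1-y_1|^\alpha+|x_2-y_2|^\alpha$. For $n\ge1$ let $x_k=2k\pi/n$ ($k=0,\dots,n$), $x_k'=(x_k+x_{k+1})/2$ ($k=0,\dots,n-1$), $\Delta_{kl}=[x_k,x_{k+1}]\times[x_l,x_{l+1}]$ ($k,l=0,\dots,n-1$). The cubature formula $$ (Kf)(s_1,s_2)=\sum_{k=0}^{n-1}\sum_{l=0}^{n-1} f(x_k',x_l')\iint_{\Delta_{kl}}\frac{d\sigma_1\,d\sigma_2}{\left(\sin^2\frac{\sigma_1-s_1}{2}+\sin^2\frac{\sigma_2-s_2}{2}\right)^{\lambda}}+R_{nn} $$ has error $$ R_{nn}[\Psi]=\frac{(2+o(1))\gamma}{1+\alpha}\left(\frac{\pi}{n}\right)^{\alpha}\qquad(n\to\infty),\qquad \gamma=\int_0^{2\pi}\!\!\int_0^{2\pi}\frac{ds_1\,ds_2}{(\sin^2(s_1/2)+\sin^2(s_2/2))^{\lambda}}, $$ and it is asymptotically optimal on $\Psi$ among all cubature formulas of the general type described in the context with $n_1=n_2=n$ and $\rho_1=\rho_2=0$.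
   Context: For $f$ on $D=[0,2\pi]^2$ and $0<\lambda<1$, $$(Kf)(s_1,s_2)=\int_0^{2\pi}\!\!\int_0^{2\pi}\frac{f(\sigma_1,\sigma_2)\,d\sigma_1 d\sigma_2}{\left(\sin^2\frac{\sigma_1-s_1}{2}+\sin^2\frac{\sigma_2-s_2}{2}\right)^{\lambda}},\quad 0\le s_1,s_2\le 2\pi.$$ General cubature formulas with parameters $n_1,n_2,\rho_1,\rho_2$: $$Kf=\sum_{k_1=1}^{n_1}\sum_{k_2=1}^{n_2}\sum_{l_1=0}^{\rho_1}\sum_{l_2=0}^{\rho_2}p_{k_1k_2l_1l_2}(s_1,s_2)f^{(l_1,l_2)}(x_{k_1},y_{k_2})+R_{n_1n_2}(f;p;x,y;s_1,s_2),$$ with arbitrary coefficient functions $p_{k_1k_2l_1l_2}$ and arbitrary nodes $(x_{k_1},y_{k_2})\in D$; $f^{(l_1,l_2)}=\partial^{l_1+l_2}f/\partial s_1^{l_1}\partial s_2^{l_2}$. The error of a formula on a class $\Psi$ is $R_{n_1n_2}[\Psi]=R_{n_1n_2}(\Psi;p;x,y)=\sup_{f\in\Psi}\sup_{(s_1,s_2)\in D}|R_{n_1n_2}(f;p;x,y;s_1,s_2)|$, and $\zeta_{n_1n_2}[\Psi]=\inf_{p;x,y}R_{n_1n_2}(\Psi;p;x,y)$. A formula (sequence of formulas) with $n_1=n_2=n$ is asymptotically optimal on $\Psi$ if its error on $\Psi$ divided by $\zeta_{nn}[\Psi]$ tends to $1$ as $n\to\infty$. *)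

(* Defs.v *)
From HB Require Import structures.
From mathcomp Require Import all_boot all_order all_algebra.
From mathcomp Require Import lra.
From mathcomp Require Import all_classical all_reals all_analysis.

Set Implicit Arguments.
Unset Strict Implicit.
Unset Printing Implicit Defensive.

Import Order.TTheory GRing.Theory Num.Theory.
Import numFieldNormedType.Exports.

Local Open Scope classical_set_scope.
Local Open Scope ring_scope.

(* Functions on the square D = [0, 2 pi]^2 are represented by total functions
   R * R -> R; every definition below depends only on their values on D. *)

Definition period_itv {R : realType} : set R := `[0, 2 * pi].

Definition square {R : realType} : set (R * R) := period_itv `*` period_itv.

Notation leb2 := (lebesgue_measure \x lebesgue_measure)%E.

(* On the null set where the base vanishes the value is 0 (inverse of 0). *)
Definition kern {R : realType} (lambda : R) (u : R * R) : R :=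
  (((sin (u.1 / 2)) ^+ 2 + (sin (u.2 / 2)) ^+ 2) `^ lambda)^-1.

Definition Kop {R : realType} (lambda : R) (f : R * R -> R) (s : R * R) : R :=
  \int[leb2]_(t in square) (f t * kern lambda (t.1 - s.1, t.2 - s.2)).

Definition gammaK {R : realType} (lambda : R) : R :=
  \int[leb2]_(s in square) kern lambda s.

(* Derivative of a function on [0, 2 pi], one-sided at the end points.
   The value is meaningful only where the limit exists. *)
Definition itv_deriv {R : realType} (g : R -> R) (u : R) : R :=
  lim (h^-1 * (g (u + h) - g u)
       @[h --> within [set h | period_itv (u + h)] 0^']).

(* f^(l1, l2); the order zero derivative is f itself, whatever f is. *)
Definition mixed_deriv {R : realType} (l1 l2 : nat) (f : R * R -> R)
    (z : R * R) : R :=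
  iter l1 itv_deriv (fun u => iter l2 itv_deriv (fun v => f (u, v)) z.2) z.1.

(* Nodes are indexed from 0.  The coefficient attached to
   f^(l1, l2) (xnode k1, ynode k2) is an arbitrary function of s. *)
Record cubature (R : realType) (n1 n2 rho1 rho2 : nat) := Cubature {
  coef : 'I_n1 -> 'I_n2 -> 'I_rho1.+1 -> 'I_rho2.+1 -> R * R -> R ;
  xnode : 'I_n1 -> R ;
  ynode : 'I_n2 -> R ;
  xnodeP : forall k, period_itv (xnode k) ;
  ynodeP : forall k, period_itv (ynode k) }.

Section Errors.
Context {R : realType} (lambda : R) {n1 n2 rho1 rho2 : nat}.

Definition remainder (F : cubature R n1 n2 rho1 rho2) (f : R * R -> R)
    (s : R * R) : R :=
  Kop lambda f s -
  \sum_(k1 < n1) \sum_(k2 < n2) \sum_(l1 < rho1.+1) \sum_(l2 < rho2.+1)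
    coef F k1 k2 l1 l2 s * mixed_deriv l1 l2 f (xnode F k1, ynode F k2).

Definition class_error (Psi : set (R * R -> R))
    (F : cubature R n1 n2 rho1 rho2) : \bar R :=
  ereal_sup [set ereal_sup [set (`|remainder F f s|)%:E | s in square]
            | f in Psi].

End Errors.

Definition zeta_opt {R : realType} (lambda : R) (n1 n2 rho1 rho2 : nat)
    (Psi : set (R * R -> R)) : \bar R :=
  ereal_inf (range (fun F : cubature R n1 n2 rho1 rho2 =>
                      class_error lambda Psi F)).

(* The quotient is that of \bar R, where 0 / 0 = 0, +oo / +oo = 0 and
   c / 0 = +oo for c > 0: convergence to 1 forces the error and the optimum
   to be eventually positive and finite. *)
Definition asymptotically_optimal {R : realType} (lambda : R)
    (rho1 rho2 : nat) (Psi : set (R * R -> R))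
    (F : forall n, cubature R n n rho1 rho2) : Prop :=
  (class_error lambda Psi (F n) / zeta_opt lambda n n rho1 rho2 Psi)%E
    @[n --> \oo] --> 1%E.

Definition holder_class {R : realType} (alpha : R) : set (R * R -> R) :=
  [set f | forall x y, square x -> square y ->
     `|f x - f y| <= `|x.1 - y.1| `^ alpha + `|x.2 - y.2| `^ alpha].

Definition grid_pt {R : realType} (n k : nat) : R := 2 * k%:R * pi / n%:R.

Definition grid_mid {R : realType} (n k : nat) : R :=
  (grid_pt n k + grid_pt n k.+1) / 2.

Definition grid_cell {R : realType} (n k l : nat) : set (R * R) :=
  `[grid_pt n k, grid_pt n k.+1] `*` `[grid_pt n l, grid_pt n l.+1].

Lemma grid_pt_itv {R : realType} (n k : nat) :
  (k <= n)%N -> period_itv (grid_pt n k : R).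
Proof.
move=> kn; have p0 : 0 <= pi :> R by exact: pi_ge0.
rewrite /period_itv /= in_itv /= /grid_pt; apply/andP; split.
  by rewrite !mulr_ge0 ?invr_ge0.
case: n kn => [|n] kn; first by rewrite invr0 mulr0 mulr_ge0.
rewrite ler_pdivrMr ?ltr0n// -[leLHS]mulrA -[leRHS]mulrA ler_pM2l//.
by rewrite mulrC ler_wpM2l// ler_nat.
Qed.

Lemma grid_mid_itv {R : realType} (n : nat) (k : 'I_n) :
  period_itv (grid_mid n k : R).
Proof.
have := @grid_pt_itv R n k (ltnW (ltn_ord k)).
have := @grid_pt_itv R n k.+1 (ltn_ord k).
rewrite /period_itv /= !in_itv /= /grid_mid => /andP[? ?] /andP[? ?].
by apply/andP; split; lra.
Qed.

Definition midpoint_cubature {R : realType} (lambda : R) (n : nat) :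
    cubature R n n 0 0 :=
  Cubature
    (fun k l _ _ s =>
       \int[leb2]_(t in grid_cell n k l) kern lambda (t.1 - s.1, t.2 - s.2))
    (@grid_mid_itv R n) (@grid_mid_itv R n).

(* Main.v *)
From HB Require Import structures.
From mathcomp Require Import all_boot all_order all_algebra.
From mathcomp Require Import lra ring.
From mathcomp Require Import all_classical all_reals all_analysis.
From mathcomp Require Import measurable_realfun.
Require Import Defs.

(** On sums [a t.1 + b t.2] of nonnegative functions of one variable the operator
    [Kop] splits into two convolutions on the circle with the marginal kernel
    [marginal u], the integral of [kern (u, v)] over one period in [v]; its
    integral over a period is [gammaK], which is finite because
    [kern (u, v)] is dominated by a product of integrable functions of [u] and
    of [v].

    Lower bound. Given a formula with nodes [(x k, y l)], the function
    [dist (t.1, x) ^ alpha + dist (t.2, y) ^ alpha] belongs to the class and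
    vanishes at all nodes, so that its remainder is its image under [Kop]. The
    supremum of this image is at least its mean ([conv_mean_le]), that is,
    [gammaK / (2 pi)] times the sum of the integrals of the two distances, and
    among all sets of [n] nodes such an integral is smallest for midpoints of a
    uniform grid ([integral_node_dist_ge]). This gives the bound
    [2 gammaK / (1 + alpha) * (pi / n) ^ alpha] for every [n]
    ([class_error_ge]).

    Upper bound. The Hoelder condition bounds the remainder of the midpoint
    formula at [s] by the convolutions, at [s.1] and at [s.2], of the power of the
    distance to the nearest midpoint ([remainder_midpoint_le]). This power has
    period [2 pi / n] and mean [(pi / n) ^ alpha / (1 + alpha)]. By an argument of
    Fejer, its convolution with an integrable kernel is asymptotically at most,
    uniformly on the circle, the product of this mean with the integral of the
    kernel ([conv_cell_dev_le]): on each cell a continuous approximation of the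
    kernel is almost constant.

    The optimal error lies between the lower bound and the error of the midpoint
    formula, so that both claims follow by squeezing. *)

Set Implicit Arguments.
Unset Strict Implicit.
Unset Printing Implicit Defensive.

Import Order.TTheory GRing.Theory Num.Theory.
Import numFieldNormedType.Exports.

Local Open Scope classical_set_scope.
Local Open Scope ring_scope.

(** * Translations and periodic functions *)

Definition period_co {R : realType} : set R := `[0, 2 * pi[.

Lemma lebesgue_measure_translation {R : realType} (s : R) (A : set R) :
  measurable A ->
  pushforward lebesgue_measure ((fun t => t - s) : _ -> measurableTypeR R) A =
  lebesgue_measure A.
Proof.
have mt : measurable_fun setT
    ((fun t => t - s) : measurableTypeR R -> measurableTypeR R).
  exact: measurable_funB.
pose phi : {mfun measurableTypeR R >-> measurableTypeR R} :=
  HB.pack ((fun t => t - s) : measurableTypeR R -> measurableTypeR R)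
    (isMeasurableFun.Build _ _ _ _ _ mt).
move=> mA; apply/esym.
apply: (@lebesgue_measure_unique _ (pushforward lebesgue_measure phi)) => //=.
move=> _ [[a b]] _ <-; rewrite /pushforward/=.
have -> : (fun t : R => t - s) @^-1` `]a, b] = `](a + s), (b + s)]%classic.
  by apply/seteqP; split => x /=; rewrite !in_itv/= ltrBrDr lerBlDr.
rewrite !lebesgue_measure_itv/= !lte_fin ltrD2r !EFinN -!EFinB.
by rewrite opprD addrACA subrr addr0.
Qed.

Lemma ge0_integral_translation {R : realType} (s : R) (A : set R)
    (f : R -> \bar R) : measurable A -> measurable_fun setT f ->
  (forall t, 0 <= f t)%E ->
  (\int[lebesgue_measure]_(t in (fun t : R => (t - s)%R) @^-1` A) f (t - s)%R =
   \int[lebesgue_measure]_(t in A) f t)%E.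
Proof.
move=> mA mf f0.
have mt : measurable_fun setT
    ((fun t => t - s) : measurableTypeR R -> measurableTypeR R).
  exact: measurable_funB.
rewrite -(@ge0_integral_pushforward _ _ _ _ _ _ mt lebesgue_measure A f)//.
  by apply: eq_measure_integral => B mB _; exact: lebesgue_measure_translation.
exact: measurable_funS mf.
Qed.

Lemma ge0_integral_opp {R : realType} (A : set R) (f : R -> \bar R) :
  measurable A -> measurable_fun setT f -> (forall t, 0 <= f t)%E ->
  (\int[lebesgue_measure]_(t in -%R @^-1` A) f (- t)%R =
   \int[lebesgue_measure]_(t in A) f t)%E.
Proof.
move=> mA mf f0.
have mN : measurable_fun setT (-%R : measurableTypeR R -> measurableTypeR R).
  exact: oppr_measurable.
rewrite -(@ge0_integral_pushforward _ _ _ _ _ _ mN lebesgue_measure A f)//.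
  by apply: eq_measure_integral => B mB _; exact: lebesgue_measureN.
exact: measurable_funS mf.
Qed.

(** Cutting the period at the point that is moved to the origin, translation
    exchanges the two pieces up to one period. *)
Lemma ge0_integral_period {R : realType} (f : R -> \bar R) (s : R) :
  measurable_fun setT f -> (forall t, 0 <= f t)%E ->
  (forall t, f (t + 2 * pi) = f t) -> period_itv s ->
  (\int[lebesgue_measure]_(t in period_co) f (t - s)%R =
   \int[lebesgue_measure]_(t in period_co) f t)%E.
Proof.
move=> mf f0 fper; rewrite /period_itv/= in_itv/= => /andP[s0 s2].
have fper' t : f t = f (t - 2 * pi) by rewrite -[in RHS]fper subrK.
have mfs (A : set R) : measurable_fun A f by exact: measurable_funS mf.
rewrite (_ : period_co = (fun t => t - s) @^-1` `[(- s)%R, (2 * pi - s)%R[);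
  last first.
  apply/seteqP; split => x; rewrite /period_co/= !in_itv/=;
  by move=> /andP[? ?]; apply/andP; split; lra.
rewrite ge0_integral_translation//.
have E1 (a b c : R) : a <= b -> b <= c ->
    (\int[lebesgue_measure]_(t in `[a, c[) f t =
     \int[lebesgue_measure]_(t in `[a, b[) f t +
     \int[lebesgue_measure]_(t in `[b, c[) f t)%E.
  move=> ab bc.
  rewrite (_ : `[a, c[%classic = `[a, b[ `|` `[b, c[); last first.
    by rewrite -itv_bndbnd_setU// bnd_simp.
  rewrite ge0_integral_setU//; first exact: mfs.
  apply/disj_setPS => x /= [].
  by rewrite !in_itv/= => /andP[_ ?] /andP[? _]; lra.
rewrite (E1 _ 0) ?oppr_le0 ?subr_ge0//.
rewrite (_ : _ @^-1` _ = period_co); last first.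
  apply/seteqP; split => x; rewrite /period_co/= !in_itv/=;
  by move=> /andP[? ?]; apply/andP; split; lra.
rewrite /period_co (E1 0 (2 * pi - s) (2 * pi)) ?subr_ge0// ?gerBl// addeC.
congr (_ + _)%E.
rewrite -(@ge0_integral_translation _ (2 * pi))//.
under eq_integral do rewrite -fper'.
congr (integral _ _ _); apply/seteqP; split => x; rewrite /= !in_itv/=;
by move=> /andP[? ?]; apply/andP; split; lra.
Qed.

(** * The kernel and its marginal *)

(** Extending the integrand by zero outside the rectangle reduces this to
    Tonelli's theorem on the whole product. *)
Lemma ge0_integral_rect d1 d2 (T1 : measurableType d1) (T2 : measurableType d2)
    (R : realType) (m1 : {sigma_finite_measure set T1 -> \bar R})
    (m2 : {sigma_finite_measure set T2 -> \bar R}) (A : set T1) (B : set T2)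
    (f : T1 * T2 -> \bar R) : measurable A -> measurable B ->
  measurable_fun setT f -> (forall t, 0 <= f t)%E ->
  (\int[m1 \x m2]_(t in A `*` B) f t =
   \int[m1]_(x in A) \int[m2]_(y in B) f (x, y))%E /\
  (\int[m1 \x m2]_(t in A `*` B) f t =
   \int[m2]_(y in B) \int[m1]_(x in A) f (x, y))%E.
Proof.
move=> mA mB mf f0.
have mAB : measurable (A `*` B) by exact: measurableX.
have mg : measurable_fun setT (f \_ (A `*` B)).
  by apply/(measurable_restrictT _ _).1 => //; exact: measurable_funS mf.
have g0 t : (0 <= (f \_ (A `*` B)) t)%E by rewrite patchE; case: ifPn.
rewrite integral_mkcond; split.
  rewrite (fubini_tonelli1 _ mg g0) [RHS]integral_mkcond; apply: eq_integral => x _.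
  rewrite /fubini_F patchE; case: ifPn => xA.
    rewrite [RHS]integral_mkcond; apply: eq_integral => y _.
    by rewrite !patchE in_setX xA.
  by apply: integral0_eq => y _; rewrite patchE in_setX (negbTE xA).
rewrite (fubini_tonelli2 _ mg g0) [RHS]integral_mkcond; apply: eq_integral => y _.
rewrite /fubini_G patchE; case: ifPn => yB.
  rewrite [RHS]integral_mkcond; apply: eq_integral => x _.
  by rewrite !patchE in_setX yB andbT.
by apply: integral0_eq => x _; rewrite patchE in_setX (negbTE yB) andbF.
Qed.

Lemma measurable_fun_inner_integral d1 d2 (T1 : measurableType d1)
    (T2 : measurableType d2) (R : realType)
    (m2 : {sigma_finite_measure set T2 -> \bar R}) (B : set T2)
    (f : T1 * T2 -> \bar R) : measurable B ->
  measurable_fun setT f -> (forall t, 0 <= f t)%E ->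
  measurable_fun setT (fun x => \int[m2]_(y in B) f (x, y))%E.
Proof.
move=> mB mf f0.
have mTB : measurable ([set: T1] `*` B) by exact: measurableX.
have mg : measurable_fun setT (f \_ ([set: T1] `*` B)).
  by apply/(measurable_restrictT _ _).1 => //; exact: measurable_funS mf.
have g0 t : (0 <= (f \_ ([set: T1] `*` B)) t)%E by rewrite patchE; case: ifPn.
have := measurable_fun_fubini_tonelli_F (m2 := m2) _ mg g0.
apply: eq_measurable_fun => x _.
rewrite /fubini_F [RHS]integral_mkcond; apply: eq_integral => y _.
by rewrite !patchE in_setX in_setT.
Qed.

Lemma measurable_kern {R : realType} (lambda : R) :
  measurable_fun setT (kern lambda).
Proof.
rewrite /kern.
have ms : measurable_fun setT (@sin R).
  by apply: continuous_measurable_fun => x; exact: continuous_sin.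
have mh : measurable_fun setT (fun x : R => sin (x / 2) ^+ 2).
  apply: measurable_funX; apply: measurableT_comp => //.
  exact: measurable_funM.
apply: (eq_measurable_fun (fun u : R * R =>
  ((sin (u.1 / 2)) ^+ 2 + (sin (u.2 / 2)) ^+ 2) `^ (- lambda))).
  by move=> u _; rewrite powRN.
apply: (@measurableT_comp _ _ _ _ _ _ (@powR R ^~ (- lambda))).
  exact: measurable_powR.
by apply: measurable_funD; apply: (measurableT_comp mh);
  [exact: measurable_fst | exact: measurable_snd].
Qed.

Lemma kern_ge0 {R : realType} (lambda : R) u : 0 <= kern lambda u.
Proof. by rewrite invr_ge0 powR_ge0. Qed.

Lemma kernC {R : realType} (lambda : R) u v :
  kern lambda (u, v) = kern lambda (v, u).
Proof. by rewrite /kern/= addrC. Qed.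

Lemma kernN {R : realType} (lambda : R) u v :
  kern lambda (- u, v) = kern lambda (u, v).
Proof. by rewrite /kern/= mulNr sinN sqrrN. Qed.

Lemma kern_period {R : realType} (lambda : R) u v :
  kern lambda (u + 2 * pi, v) = kern lambda (u, v).
Proof.
by rewrite /kern/= mulrDl [2 * pi]mulrC mulfK// sinDpi sqrrN.
Qed.

(** Integrating a function of a single variable against the kernel on the square
    amounts to convolving it with this function on the circle. *)
Definition marginal {R : realType} (lambda : R) (u : R) : \bar R :=
  (\int[lebesgue_measure]_(v in period_co) (kern lambda (u, v))%:E)%E.

Section Marginal.
Context {R : realType}.
Variable lambda : R.

Lemma measurable_marginal : measurable_fun setT (marginal lambda).
Proof.
apply: (@measurable_fun_inner_integral _ _ _ _ R
  lebesgue_measure period_co (EFin \o kern lambda)).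
- by rewrite /period_co.
- by apply/measurable_EFinP; exact: measurable_kern.
- by move=> t; rewrite lee_fin kern_ge0.
Qed.

Lemma marginal_ge0 u : (0 <= marginal lambda u)%E.
Proof. by apply: integral_ge0 => v _; rewrite lee_fin kern_ge0. Qed.

Lemma marginalN u : marginal lambda (- u) = marginal lambda u.
Proof. by apply: eq_integral => v _; rewrite kernN. Qed.

Lemma marginal_period u : marginal lambda (u + 2 * pi) = marginal lambda u.
Proof. by apply: eq_integral => v _; rewrite kern_period. Qed.

Lemma integral_kern_shift u s : period_itv s ->
  (\int[lebesgue_measure]_(v in period_co) (kern lambda (u, v - s))%:E =
   marginal lambda u)%E.
Proof.
move=> Js.
apply: (@ge0_integral_period _ (fun v => (kern lambda (u, v))%:E) s) => //.
- by apply/measurable_EFinP/(measurableT_comp (measurable_kern lambda)).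
- by move=> t; rewrite lee_fin kern_ge0.
- by move=> t; rewrite kernC kern_period kernC.
Qed.

Lemma integral_marginal_shift s : period_itv s ->
  (\int[lebesgue_measure]_(t in period_co) marginal lambda (t - s)%R =
   \int[lebesgue_measure]_(t in period_co) marginal lambda t)%E.
Proof.
apply: ge0_integral_period; [exact: measurable_marginal|
  exact: marginal_ge0|exact: marginal_period].
Qed.

(** By Tonelli's theorem the variable that a term does not involve can be
    integrated out first; periodicity removes its shift. *)
Lemma integral_add_kern (a b : R -> R) (s : R * R) : square s ->
  measurable_fun setT a -> measurable_fun setT b ->
  (forall t, 0 <= a t) -> (forall t, 0 <= b t) ->
  (\int[leb2]_(t in period_co `*` period_co)
     ((a t.1 + b t.2) * kern lambda (t.1 - s.1, t.2 - s.2))%:E =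
   \int[lebesgue_measure]_(t in period_co)
     ((a t)%:E * marginal lambda (t - s.1)%R) +
   \int[lebesgue_measure]_(t in period_co)
     ((b t)%:E * marginal lambda (t - s.2)%R))%E.
Proof.
move=> [s1 s2] ma mb a0 b0.
have mJ : measurable (@period_co R) by rewrite /period_co.
have mk : measurable_fun setT
    (fun t : R * R => kern lambda (t.1 - s.1, t.2 - s.2)).
  apply: (measurableT_comp (measurable_kern lambda)).
  by apply: measurable_fun_pair; apply: measurable_funB.
have ma' : measurable_fun setT (fun t : R * R => (a t.1 *
    kern lambda (t.1 - s.1, t.2 - s.2))%:E).
  apply/measurable_EFinP; apply: measurable_funM => //.
  by apply: (measurableT_comp ma); exact: measurable_fst.
have mb' : measurable_fun setT (fun t : R * R => (b t.2 *
    kern lambda (t.1 - s.1, t.2 - s.2))%:E).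
  apply/measurable_EFinP; apply: measurable_funM => //.
  by apply: (measurableT_comp mb); exact: measurable_snd.
under eq_integral do rewrite mulrDl EFinD.
rewrite ge0_integralD//; last 5 first.
- exact: measurableX.
- by move=> t _; rewrite lee_fin mulr_ge0// kern_ge0.
- exact: measurable_funS ma'.
- by move=> t _; rewrite lee_fin mulr_ge0// kern_ge0.
- exact: measurable_funS mb'.
have mk1 (D : set R) u v :
    measurable_fun D (fun y : R => (kern lambda (u, y - v))%:E).
  apply: measurable_funTS.
  apply/measurable_EFinP; apply: (measurableT_comp (measurable_kern lambda)).
  by apply: measurable_fun_pair => //; apply: measurable_funB.
congr (_ + _)%E.
  rewrite (@ge0_integral_rect _ _ _ _ R lebesgue_measure lebesgue_measure
    _ _ _ mJ mJ ma' _).1; last first.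
    by move=> t; rewrite lee_fin mulr_ge0// kern_ge0.
  apply: eq_integral => x _ /=.
  under eq_integral do rewrite EFinM.
  rewrite ge0_integralZl; last 4 first.
  - exact: mJ.
  - exact: (mk1 _ (x - s.1) s.2).
  - by move=> y _; rewrite lee_fin kern_ge0.
  - by rewrite lee_fin.
  by rewrite integral_kern_shift.
rewrite (@ge0_integral_rect _ _ _ _ R lebesgue_measure lebesgue_measure
    _ _ _ mJ mJ mb' _).2; last first.
  by move=> t; rewrite lee_fin mulr_ge0// kern_ge0.
apply: eq_integral => x _ /=.
under eq_integral do rewrite EFinM kernC.
rewrite ge0_integralZl; last 4 first.
- exact: mJ.
- exact: (mk1 _ (x - s.2) s.1).
- by move=> y _; rewrite lee_fin kern_ge0.
- by rewrite lee_fin.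
by rewrite integral_kern_shift.
Qed.

End Marginal.

(** * Integrability of the singularity *)

(** The fundamental theorem of calculus applies on compact subintervals, which
    exhaust the open interval; this yields integrability also when [f] blows up
    at the end points. *)
Lemma ge0_integral_derivative_le {R : realType} (F f : R -> R) (a b M : R) :
  a < b -> (forall x, a < x < b -> is_derive x (1 : R) F (f x)) ->
  (forall x, a < x < b -> {for x, continuous f}) ->
  (forall x, a < x < b -> 0 <= f x) -> (forall x, a < x < b -> `|F x| <= M) ->
  measurable_fun setT f ->
  (\int[lebesgue_measure]_(x in `]a, b[) (f x)%:E <= (M + M)%:E)%E.
Proof.
move=> ab dF cf f0 FM mf.
pose e n : R := (b - a) / n.+3%:R.
have e0 n : 0 < e n by rewrite divr_gt0 ?subr_gt0.
have e3 n : e n <= (b - a) / 3.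
  rewrite /e ler_pM2l ?subr_gt0// lef_pV2 ?posrE//.
  by rewrite ler_nat.
pose G n : set R := `[(a + e n), (b - e n)]%classic.
have Gab n x : G n x -> a < x < b.
  rewrite /G/= in_itv/= => /andP[? ?]; have := e0 n => ?.
  by apply/andP; split; lra.
have UG : \bigcup_n G n = `]a, b[%classic.
  apply/seteqP; split => x /=; first by move=> [n _ /Gab]; rewrite in_itv.
  rewrite in_itv/= => /andP[ax xb].
  have m0 : 0 < Num.min (x - a) (b - x) by rewrite lt_min !subr_gt0 ax.
  have [N HN] : exists N, e N <= Num.min (x - a) (b - x).
    have m1 : 0 < Num.min (x - a) (b - x) / (b - a).
      by rewrite divr_gt0// subr_gt0.
    have [k] := ltr_add_invr m1; rewrite add0r => /ltW km; exists k.
    rewrite /e mulrC -ler_pdivlMr ?subr_gt0//; apply: le_trans km.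
    by rewrite lef_pV2 ?posrE// ler_nat ltnW.
  exists N => //; rewrite /G/= in_itv/=; move: HN; rewrite le_min => /andP[? ?].
  by apply/andP; split; lra.
rewrite -UG.
have mG n : measurable (G n) by exact: measurable_itv.
have ndG : nondecreasing_seq G.
  move=> m n mn; apply/subsetPset => x; rewrite /G/= !in_itv/= => /andP[? ?].
  have : e n <= e m by rewrite /e ler_pM2l ?subr_gt0// lef_pV2 ?posrE// ler_nat.
  by move=> ?; apply/andP; split; lra.
have mfG n : measurable_fun (G n) (EFin \o f).
  by apply/measurable_EFinP; exact: measurable_funTS.
have f0' n x : G n x -> (0 <= (EFin \o f) x)%E.
  by move=> /Gab abx; rewrite lee_fin f0.
rewrite -(cvg_lim _ (ge0_nondecreasing_set_cvg_integral
  (mu := @lebesgue_measure R) ndG mG mfG f0'))//.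
apply: lime_le.
  by apply: ereal_nondecreasing_is_cvgn;
    exact: ge0_nondecreasing_set_nondecreasing_integral.
apply: nearW => n.
have ab' : a + e n < b - e n by have := e3 n; have := e0 n => ? ?; lra.
have itvab x : x \in `[(a + e n), (b - e n)] -> a < x < b by move=> /Gab.
have abl : a < a + e n < b by apply: itvab; rewrite in_itv/= lexx/= ltW.
have abr : a < b - e n < b by apply: itvab; rewrite in_itv/= lexx/= ltW.
have cF x : a < x < b -> {for x, continuous F}.
  move=> /dF dFx; apply/differentiable_continuous/derivable1_diffP.
  exact: ex_derive.
rewrite (@continuous_FTC2 _ _ F)//.
- rewrite -EFinB lee_fin.
  by rewrite (le_trans (ler_norm _))// (le_trans (ler_normB _ _))// lerD// FM.
- apply: continuous_in_subspaceT => x; rewrite inE => /itvab; exact: cf.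
- split; last 2 first.
  + exact/cvg_at_right_filter/cF.
  + exact/cvg_at_left_filter/cF.
  + by move=> x /subset_itv_oo_cc /itvab /dF dFx; exact: ex_derive.
- move=> x /subset_itv_oo_cc /itvab /dF dFx.
  by rewrite derive1E derive_val.
Qed.

Section KernelIntegrable.
Context {R : realType}.
Variable lambda : R.
Hypothesis lambda01 : 0 < lambda < 1.
Let l0 : 0 < lambda. Proof. by case/andP: lambda01. Qed.
Let l1 : lambda < 1. Proof. by case/andP: lambda01. Qed.

Lemma sin_half_gt0 (u : R) : 0 < u < 2 * pi -> 0 < sin (u / 2).
Proof. by move=> /andP[? ?]; rewrite sin_gt0_pi//; apply/andP; split; lra. Qed.

(** With [S = sin (u / 2)], the derivative of
    [S ^ (1 - lambda) cos (u / 2) + u] is at least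
    [(1 - lambda) / 2 * S ^ (- lambda)], while the function itself is bounded. *)
Lemma integral_sin_powR_fin :
  (\int[lebesgue_measure]_(u in `]0%R, (2 * pi)%R[)
     (sin (u / 2) `^ (- lambda))%:E < +oo)%E.
Proof.
pose S (u : R) := sin (u / 2).
pose C (u : R) := cos (u / 2).
pose F (u : R) := S u `^ (1 - lambda) * C u + u.
pose f (u : R) := 2^-1 * ((1 - lambda) * S u `^ (- lambda) * C u ^+ 2 -
  S u `^ (1 - lambda) * S u) + 1.
have dh (u : R) : is_derive u (1 : R) (fun u : R => u / 2) (2^-1).
  rewrite (_ : (fun u : R => u / 2) = 2^-1 \*: id); last first.
    by apply/funext => x; rewrite /= mulrC.
  by apply: is_derive_eq; rewrite /GRing.scale/= mulr1.
have dS (u : R) : is_derive u (1 : R) S (C u / 2).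
  exact: (@is_derive1_comp _ sin (fun u => u / 2) u _ _ (is_derive_sin (u / 2)) (dh u)).
have dC (u : R) : is_derive u (1 : R) C (- S u / 2).
  exact: (@is_derive1_comp _ cos (fun u => u / 2) u _ _ (is_derive_cos (u / 2)) (dh u)).
have cS : continuous S.
  move=> x; apply/differentiable_continuous/derivable1_diffP; exact: ex_derive.
have cC : continuous C.
  move=> x; apply/differentiable_continuous/derivable1_diffP; exact: ex_derive.
have mS : measurable_fun setT S by exact: continuous_measurable_fun.
have mC : measurable_fun setT C by exact: continuous_measurable_fun.
have mSp p : measurable_fun setT (fun u => S u `^ p).
  by apply: (@measurableT_comp _ _ _ _ _ _ (@powR R ^~ p)).
have mf : measurable_fun setT f.
  apply: measurable_funD => //; apply: measurable_funM => //.
  apply: measurable_funB; last exact: measurable_funM.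
  by apply: measurable_funM; [apply: measurable_funM|apply: measurable_funX].
have dF u : 0 < u < 2 * pi -> is_derive u (1 : R) F (f u).
  move=> /sin_half_gt0 S0.
  have dSp := @is_derive1_comp _ (@powR R ^~ (1 - lambda)) S u _ _
    (is_derive1_powR (1 - lambda) S0) (dS u).
  have := @is_deriveD _ _ _ _ _ _ _ _ _
    (@is_deriveM _ _ _ _ _ _ _ _ dSp (dC u)) (is_derive_id u (1 : R)).
  move/is_derive_eq; apply; rewrite /GRing.scale/= /f.
  rewrite (_ : 1 - lambda - 1 = - lambda); last by ring.
  by rewrite /S/=; field.
have cSp p u : 0 < u < 2 * pi -> {for u, continuous (fun u => S u `^ p)}.
  move=> /sin_half_gt0 S0.
  have dSp := @is_derive1_comp _ (@powR R ^~ p) S u _ _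
    (is_derive1_powR p S0) (dS u).
  apply/differentiable_continuous/derivable1_diffP; exact: ex_derive.
have cf u : 0 < u < 2 * pi -> {for u, continuous f}.
  move=> u2; apply: cvgD; last exact: cvg_cst.
  apply: cvgM; first exact: cvg_cst.
  apply: cvgB; last by apply: cvgM; [exact: cSp|exact: cS].
  apply: cvgM; last by apply: cvgM; exact: cC.
  by apply: cvgM; [exact: cvg_cst|exact: cSp].
have Sle u : S u <= 1 by exact: sin_le1.
have Sp1 u : 0 < S u -> S u `^ (1 - lambda) <= 1.
  move=> S0; apply: (@le_trans _ _ (1 `^ (1 - lambda))); last by rewrite powR1.
  by rewrite ge0_ler_powR ?nnegrE ?subr_ge0// ltW.
have fS u : 0 < u < 2 * pi -> (1 - lambda) / 2 * S u `^ (- lambda) <= f u.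
  move=> /sin_half_gt0 S0.
  have TS : S u `^ (1 - lambda) = S u `^ (- lambda) * S u.
    rewrite addrC powRD ?powRr1//; first exact: ltW.
    by rewrite (gt_eqF S0) implybT.
  have QS : S u `^ (1 - lambda) * S u <= 1.
    rewrite mulr_ile1 ?powR_ge0//; first exact: ltW.
    exact: Sp1.
  rewrite /f /C cos2sin2 -/(S u); rewrite TS in QS *.
  move: (S u `^ (- lambda)) QS => T QS; move: (S u) QS => s QS.
  have l2 : 0 <= 2 - lambda by rewrite subr_ge0 (le_trans (ltW l1))// ler1n.
  have : (2 - lambda) * (T * s * s) <= (2 - lambda) * 1 by rewrite ler_wpM2l.
  move: (ltW l0); clear => l0' h; rewrite expr2; nra.
have f0 u : 0 < u < 2 * pi -> 0 <= f u.
  move=> u2; apply: le_trans (fS u u2).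
  by rewrite mulr_ge0 ?powR_ge0// divr_ge0// subr_ge0 ltW.
have FM u : 0 < u < 2 * pi -> `|F u| <= 1 + 2 * pi.
  move=> /[dup] /sin_half_gt0 S0 /andP[u0 u2].
  rewrite (le_trans (ler_normD _ _))// lerD//; last by rewrite gtr0_norm// ltW.
  rewrite normrM; apply: mulr_ile1 => //.
    by rewrite ger0_norm ?powR_ge0//; exact: Sp1.
  by rewrite ler_norml cos_geN1 cos_le1.
have := ge0_integral_derivative_le _ dF cf f0 FM mf.
rewrite mulr_gt0 ?pi_gt0// => /(_ isT) Ff.
apply: (@le_lt_trans _ _
  ((2 / (1 - lambda))%:E * (1 + 2 * pi + (1 + 2 * pi))%:E)%E).
  apply: (@le_trans _ _ (\int[lebesgue_measure]_(u in `]0%R, (2 * pi)%R[)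
    ((2 / (1 - lambda))%:E * (f u)%:E))%E).
    apply: ge0_le_integral => //=.
    - by move=> x _; rewrite lee_fin powR_ge0.
    - apply/measurable_EFinP/measurable_funTS; exact: (mSp (- lambda)).
    - apply/measurable_EFinP/measurable_funTS.
      by apply: (measurable_funM (f := cst (2 / (1 - lambda)))).
    - move=> x; rewrite in_itv/= => x2; rewrite -EFinM lee_fin.
      rewrite mulrAC ler_pdivlMr ?subr_gt0//.
      have := fS x x2; rewrite /S; lra.
  rewrite ge0_integralZl_EFin//.
  - by rewrite lee_pmul2l// lte_fin divr_gt0// subr_gt0.
  - by apply/measurable_EFinP; exact: measurable_funTS.
  - by rewrite divr_ge0// subr_ge0 ltW.
by rewrite -EFinM ltry.
Qed.
End KernelIntegrable.

(** * The mass of the kernel *)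

Lemma measurable_period_co {R : realType} : measurable (@period_co R).
Proof. by rewrite /period_co. Qed.

(** The upper and right sides of a rectangle are negligible. *)
Lemma integral_rect_cc_co {R : realType} (a b c d : R) (f : R * R -> \bar R) :
  measurable_fun setT f ->
  (\int[leb2]_(t in `[a, b] `*` `[c, d]) f t =
   \int[leb2]_(t in `[a, b[ `*` `[c, d[) f t)%E.
Proof.
have ge0 (g : R * R -> \bar R) : measurable_fun setT g ->
    (forall t, 0 <= g t)%E ->
    (\int[leb2]_(t in `[a, b] `*` `[c, d]) g t =
     \int[leb2]_(t in `[a, b[ `*` `[c, d[) g t)%E.
  move=> mg g0.
  rewrite (@ge0_integral_rect _ _ _ _ R lebesgue_measure lebesgue_measure
    _ _ _ (measurable_itv `[a, b]) (measurable_itv `[c, d]) mg g0).1.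
  rewrite (@ge0_integral_rect _ _ _ _ R lebesgue_measure lebesgue_measure
    _ _ _ (measurable_itv `[a, b[) (measurable_itv `[c, d[) mg g0).1.
  rewrite -integral_itv_bndo_bndc; last first.
    apply: measurable_funTS.
    exact: (@measurable_fun_inner_integral _ _ _ _ R lebesgue_measure
      _ _ (measurable_itv `[c, d]) mg g0).
  apply: eq_integral => x _.
  rewrite -integral_itv_bndo_bndc//; apply: measurable_funTS.
  by apply: (measurableT_comp mg).
move=> mf; rewrite integralE [RHS]integralE ge0//; last exact: measurable_funepos.
by rewrite ge0//; exact: measurable_funeneg.
Qed.

Section KernelMass.
Context {R : realType}.
Variable lambda : R.
Hypothesis lambda01 : 0 < lambda < 1.

(** From [a b <= a ^ 2 + b ^ 2] the kernel is dominated by a product of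
    functions of one variable. *)
Lemma kern_le_sin (u v : R) : 0 < u < 2 * pi -> 0 < v < 2 * pi ->
  kern lambda (u, v) <= sin (u / 2) `^ (- lambda) * sin (v / 2) `^ (- lambda).
Proof.
move=> /sin_half_gt0 + /sin_half_gt0; rewrite /kern/=.
move: (sin (u / 2)) (sin (v / 2)) => a b a0 b0.
have q0 : 0 < a ^+ 2 + b ^+ 2 by rewrite addr_gt0// exprn_gt0.
rewrite -powRM ?(ltW a0) ?(ltW b0)// powRN lef_pV2 ?posrE ?powR_gt0 ?mulr_gt0//.
have l0 : 0 <= lambda by case/andP: lambda01 => /ltW.
rewrite ge0_ler_powR ?nnegrE ?(ltW q0)// ?mulr_ge0 ?ltW//.
by have := sqr_ge0 (a - b); have := mulr_gt0 a0 b0; rewrite !expr2; nra.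
Qed.

Lemma integral_period_oo (f : R -> \bar R) : measurable_fun setT f ->
  (\int[lebesgue_measure]_(t in period_co) f t =
   \int[lebesgue_measure]_(t in `]0%R, (2 * pi)%R[) f t)%E.
Proof.
by move=> mf; rewrite integral_itv_obnd_cbnd//; exact: measurable_funTS.
Qed.

Lemma integral_marginal_fin :
  (\int[lebesgue_measure]_(u in period_co) marginal lambda u < +oo)%E.
Proof.
pose h (u : R) := sin (u / 2) `^ (- lambda).
pose I := (\int[lebesgue_measure]_(u in `]0%R, (2 * pi)%R[) (h u)%:E)%E.
have Ioo : (I < +oo)%E by exact: integral_sin_powR_fin.
have I0 : (0 <= I)%E by apply: integral_ge0 => u _; rewrite lee_fin powR_ge0.
have Ifin : I \is a fin_num by rewrite ge0_fin_numE.
have mh (D : set R) : measurable_fun D (fun u => (h u)%:E).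
  apply/measurable_EFinP/measurable_funTS.
  apply: (@measurableT_comp _ _ _ _ _ _ (@powR R ^~ (- lambda))).
    exact: measurable_powR.
  apply: (@measurableT_comp _ _ _ _ _ _ (@sin R)).
    by apply: continuous_measurable_fun => x; exact: continuous_sin.
  exact: measurable_funM.
have mk u (D : set R) : measurable_fun D (fun v : R => (kern lambda (u, v))%:E).
  apply/measurable_EFinP/measurable_funTS.
  exact: (measurableT_comp (measurable_kern lambda)).
rewrite integral_period_oo; last exact: measurable_marginal.
apply: (@le_lt_trans _ _
  (\int[lebesgue_measure]_(u in `]0%R, (2 * pi)%R[) ((h u)%:E * I))%E).
  apply: ge0_le_integral => //=.
  - by move=> u _; exact: marginal_ge0.
  - apply: measurable_funTS; exact: measurable_marginal.
  - by apply: (emeasurable_funM (mh _) (measurable_cst I)).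
  - move=> u; rewrite in_itv/= => u2.
    rewrite /marginal integral_period_oo//.
    rewrite /I -ge0_integralZl; last 4 first.
    + exact: measurable_itv.
    + exact: mh.
    + by move=> ? _; rewrite lee_fin powR_ge0.
    + by rewrite lee_fin powR_ge0.
    apply: ge0_le_integral => //=.
    + by move=> v _; rewrite lee_fin kern_ge0.
    + exact: mk.
    + by apply: (emeasurable_funM (measurable_cst (h u)%:E) (mh _)).
    + by move=> v; rewrite in_itv/= => v2; rewrite -EFinM lee_fin kern_le_sin.
rewrite ge0_integralZr; last 4 first.
- exact: measurable_itv.
- exact: mh.
- by move=> u _; rewrite lee_fin powR_ge0.
- exact: I0.
by rewrite -/I -(fineK Ifin) -EFinM ltry.
Qed.

(** The integral defining [gammaK] in the reals loses nothing, because it is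
    finite. *)
Lemma gammaKE : (gammaK lambda)%:E =
  (\int[lebesgue_measure]_(u in period_co) marginal lambda u)%E.
Proof.
have mk : measurable_fun setT (EFin \o kern lambda).
  by apply/measurable_EFinP; exact: measurable_kern.
have k0 t : (0 <= (EFin \o kern lambda) t)%E by rewrite lee_fin kern_ge0.
rewrite /gammaK /Rintegral /square /period_itv.
rewrite (integral_rect_cc_co _ _ _ _ mk).
rewrite (@ge0_integral_rect _ _ _ _ R lebesgue_measure lebesgue_measure
    _ _ _ measurable_period_co measurable_period_co mk k0).1.
rewrite fineK// ge0_fin_numE ?integral_marginal_fin//.
by apply: integral_ge0 => u _; exact: marginal_ge0.
Qed.

(** Away from the corners of the square the kernel is at least [2 ^ - lambda]. *)
Lemma gammaK_gt0 : 0 < gammaK lambda.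
Proof.
have p0 : 0 < pi :> R := pi_gt0 R.
have l0 : 0 <= lambda by case/andP: lambda01 => /ltW.
pose c : R := (2 `^ lambda)^-1.
have c0 : 0 < c by rewrite invr_gt0 powR_gt0.
pose A : set R := `[pi / 2, pi]%classic.
have muA : lebesgue_measure A = (pi / 2)%:E.
  rewrite lebesgue_measure_itv/= lte_fin ifT; last by lra.
  by rewrite -EFinD; congr (_%:E); lra.
have mA : measurable A by exact: measurable_itv.
have intA k : (\int[lebesgue_measure]_(u in A) k%:E = (k * (pi / 2))%:E)%E.
  by rewrite EFinM -muA; apply: integral_cst; exact: measurable_itv.
have AJ : A `<=` period_co.
  move=> x; rewrite /A/period_co/= !in_itv/= => /andP[? ?].
  by apply/andP; split; lra.
rewrite -lte_fin gammaKE.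
apply: (@lt_le_trans _ _ (\int[lebesgue_measure]_(u in A) (c * (pi / 2))%:E)%E).
  rewrite intA lte_fin.
  by rewrite !mulr_gt0// invr_gt0.
apply: (@le_trans _ _
  (\int[lebesgue_measure]_(u in A) marginal lambda u)%E); last first.
  apply: ge0_subset_integral; [exact: mA|exact: measurable_period_co| | |exact: AJ].
  - by apply: measurable_funTS; exact: measurable_marginal.
  - by move=> u _; exact: marginal_ge0.
have mk u (D : set R) : measurable_fun D (fun v : R => (kern lambda (u, v))%:E).
  apply/measurable_EFinP/measurable_funTS.
  exact: (measurableT_comp (measurable_kern lambda)).
apply: ge0_le_integral => //.
- by move=> u _; rewrite lee_fin mulr_ge0// ?(ltW c0)// divr_ge0// ltW.
- apply: measurable_funTS; exact: measurable_marginal.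
move=> u Au.
apply: (@le_trans _ _
  (\int[lebesgue_measure]_(v in A) (kern lambda (u, v))%:E)%E); last first.
  apply: ge0_subset_integral; [exact: mA|exact: measurable_period_co| | |exact: AJ].
  - exact: mk.
  - by move=> v _; rewrite lee_fin kern_ge0.
have -> : (c * (pi / 2))%:E = (\int[lebesgue_measure]_(v in A) c%:E)%E.
  exact/esym/intA.
apply: ge0_le_integral; [exact: mA| |exact: measurable_cst|exact: mk|].
  by move=> v _; rewrite lee_fin ltW.
move=> v Av; rewrite lee_fin /kern/= /c.
have sA x : A x -> 0 < sin (x / 2).
  rewrite /A/= in_itv/= => /andP[? ?]; apply: sin_half_gt0.
  by apply/andP; split; lra.
have sq1 (x : R) : sin x ^+ 2 <= 1.
  by rewrite -(cos2Dsin2 x) lerDr sqr_ge0.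
have q0 : 0 < sin (u / 2) ^+ 2 + sin (v / 2) ^+ 2.
  by rewrite addr_gt0// exprn_gt0// sA.
rewrite lef_pV2 ?posrE ?powR_gt0//.
rewrite ge0_ler_powR ?nnegrE ?(ltW q0)//.
by have := sq1 (u / 2); have := sq1 (v / 2); lra.
Qed.

End KernelMass.

(** * Powers of distances *)

Section PowerDistance.
Context {R : realType}.
Variable alpha : R.
Hypothesis alpha01 : 0 < alpha <= 1.
Let a0 : 0 < alpha. Proof. by case/andP: alpha01. Qed.
Let a1 : alpha <= 1. Proof. by case/andP: alpha01. Qed.

Lemma powR_subadditive (x y : R) : 0 <= x -> 0 <= y ->
  (x + y) `^ alpha <= x `^ alpha + y `^ alpha.
Proof.
move=> x0 y0; have [xy0|xy0] := eqVneq (x + y) 0.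
  by rewrite xy0 powR0 ?gt_eqF// addr_ge0 ?powR_ge0.
have s0 : 0 < x + y by rewrite lt_def xy0 addr_ge0.
(* on [0, 1] powers of exponent at most 1 lie above the identity *)
have le_frac z : 0 <= z -> z <= x + y ->
    z / (x + y) * (x + y) `^ alpha <= z `^ alpha.
  rewrite le_eqVlt => /predU1P[<-|z0] zs; first by rewrite !mul0r powR_ge0.
  have q0 : 0 < z / (x + y) by rewrite divr_gt0.
  rewrite -{2}(divfK xy0 z) powRM ?(ltW q0) ?(ltW s0)//.
  rewrite ler_wpM2r ?powR_ge0// ger1_powR// q0/=.
  by rewrite ler_pdivrMr// mul1r.
have -> : (x + y) `^ alpha =
    x / (x + y) * (x + y) `^ alpha + y / (x + y) * (x + y) `^ alpha.
  by rewrite -mulrDl -mulrDl divff// mul1r.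
by rewrite lerD// le_frac// ?lerDl ?lerDr.
Qed.

Lemma powR_dist_holder (x t u : R) :
  `|t - x| `^ alpha <= `|u - x| `^ alpha + `|t - u| `^ alpha.
Proof.
apply: le_trans (powR_subadditive _ _) => //.
rewrite ge0_ler_powR ?nnegrE ?(ltW a0)//.
rewrite [leRHS]addrC; apply: le_trans (ler_normD _ _).
by rewrite addrA subrK.
Qed.

Lemma integral_powR (rho : R) : 0 < rho ->
  (\int[lebesgue_measure]_(t in `[0%R, rho]) (t `^ alpha)%:E =
   (rho `^ (1 + alpha) / (1 + alpha))%:E)%E.
Proof.
move=> r0; have p0 : 0 < 1 + alpha by rewrite addr_gt0.
pose F (t : R) := (1 + alpha)^-1 * t `^ (1 + alpha).
have dF (t : R) : 0 < t -> is_derive t (1 : R) F (t `^ alpha).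
  move=> t0; have dp := is_derive1_powR (1 + alpha) t0.
  rewrite (_ : F = (1 + alpha)^-1 \*: (fun t : R => t `^ (1 + alpha)))//.
  have := @is_deriveZ _ _ _ _ ((1 + alpha)^-1) _ _ _ dp.
  move/is_derive_eq; apply; rewrite /GRing.scale/=.
  rewrite mulrA mulVf ?gt_eqF// mul1r; congr (_ `^ _); ring.
have cp (t : R) : 0 < t -> {for t, continuous (fun t : R => t `^ alpha)}.
  move=> t0; apply/differentiable_continuous/derivable1_diffP.
  by apply: derivable_powR; rewrite in_itv/= andbT.
have cF (t : R) : 0 < t -> {for t, continuous F}.
  move=> t0; apply/differentiable_continuous/derivable1_diffP.
  by have := dF t t0 => ?; exact: ex_derive.
rewrite (@continuous_FTC2 _ _ F)//.
- rewrite /F powR0 ?gt_eqF// mulr0 sube0; congr (_%:E); exact: mulrC.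
- apply/continuous_within_itvP => //; split.
  + by move=> t; rewrite in_itv/= => /andP[? _]; exact: cp.
  + by rewrite powR0 ?gt_eqF//; exact: powR_cvg0.
  + exact/cvg_at_left_filter/cp.
- split.
  + move=> t; rewrite in_itv/= => /andP[t0 _]; have := dF t t0 => ?.
    exact: ex_derive.
  + rewrite /F powR0 ?gt_eqF//; apply: cvgM; first exact: cvg_cst.
    exact: powR_cvg0.
  + exact/cvg_at_left_filter/cF.
- move=> t; rewrite in_itv/= => /andP[t0 _]; have := dF t t0 => ?.
  by rewrite derive1E derive_val.
Qed.

Lemma measurable_powR_dist (c : R) :
  measurable_fun setT (fun t : R => `|t - c| `^ alpha).
Proof.
apply: (@measurableT_comp _ _ _ _ _ _ (@powR R ^~ alpha)).
  exact: measurable_powR.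
by apply: measurableT_comp => //; exact: measurable_funB.
Qed.

Lemma integral_powR_dist (c rho : R) : 0 < rho ->
  (\int[lebesgue_measure]_(t in `[(c - rho)%R, (c + rho)%R[)
     (`|t - c| `^ alpha)%:E =
   (2 * (rho `^ (1 + alpha) / (1 + alpha)))%:E)%E.
Proof.
move=> r0.
have md : measurable_fun setT (fun t : R => (`|t| `^ alpha)%:E).
  apply/measurable_EFinP; have := measurable_powR_dist 0.
  by under eq_fun do rewrite subr0.
have d0 (t : R) : (0 <= (`|t| `^ alpha)%:E)%E by rewrite lee_fin powR_ge0.
have E0 : (\int[lebesgue_measure]_(t in `[0%R, rho]) (`|t| `^ alpha)%:E =
   (rho `^ (1 + alpha) / (1 + alpha))%:E)%E.
  rewrite -(integral_powR r0); apply: eq_integral => t; rewrite inE/= in_itv/=.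
  by move=> /andP[t0 _]; rewrite ger0_norm.
transitivity (\int[lebesgue_measure]_(t in `[(- rho)%R, rho[) (`|t| `^ alpha)%:E)%E.
  rewrite -(@ge0_integral_translation _ c _ _ (measurable_itv `[(- rho), rho[)
    md d0); congr (integral _ _ _).
  by apply/seteqP; split => t; rewrite /= !in_itv/= => /andP[? ?];
    apply/andP; split; lra.
rewrite (_ : `[(- rho), rho[%classic = `[(- rho), 0[ `|` `[0, rho[); last first.
  by rewrite -itv_bndbnd_setU// bnd_simp ?oppr_le0 ltW.
rewrite ge0_integral_setU//; last 2 first.
- exact: measurable_funTS md.
- apply/disj_setPS => x /= [].
  by rewrite !in_itv/= => /andP[_ ?] /andP[? _]; lra.
rewrite !integral_itv_bndo_bndc; last 2 first.
- exact: measurable_funTS md.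
- exact: measurable_funTS md.
rewrite E0 [X in (X + _)%E](_ : _ = (rho `^ (1 + alpha) / (1 + alpha))%:E).
  by rewrite -EFinD; congr (_%:E); ring.
rewrite -E0 -(@ge0_integral_opp _ _ _ (measurable_itv `[0%R, rho]) md d0).
under [RHS]eq_integral do rewrite normrN.
congr (integral _ _ _); rewrite opp_preimage_itvbndbnd/= oppr0.
by [].
Qed.

End PowerDistance.

(** * Distance to a finite set of nodes *)

(** The cap keeps the function bounded on the line and makes sense of it without
    nodes; it does not bind on the period as soon as there is a node there. *)
Definition node_dist {R : realType} (alpha : R) n (x : 'I_n -> R) (t : R) : R :=
  \big[Order.min/(2 * pi) `^ alpha]_(k < n) `|t - x k| `^ alpha.

Section NodeDistance.
Context {R : realType}.
Variables (alpha : R) (n : nat) (x : 'I_n -> R).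
Hypothesis alpha01 : 0 < alpha <= 1.
Let a0 : 0 < alpha. Proof. by case/andP: alpha01. Qed.

Lemma node_dist_ge0 t : 0 <= node_dist alpha x t.
Proof. by apply/bigmin_geP; split => [|k _]; rewrite powR_ge0. Qed.

Lemma node_dist_le t : node_dist alpha x t <= (2 * pi) `^ alpha.
Proof. exact: bigmin_le_id. Qed.

Lemma node_dist_node k : node_dist alpha x (x k) = 0.
Proof.
apply/le_anti; rewrite node_dist_ge0 andbT.
by apply: le_trans (bigmin_le _ k _) _; rewrite subrr normr0 powR0// gt_eqF.
Qed.

Lemma node_dist_holder t u :
  `|node_dist alpha x t - node_dist alpha x u| <= `|t - u| `^ alpha.
Proof.
have le_dist a b : node_dist alpha x a <= node_dist alpha x b + `|a - b| `^ alpha.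
  rewrite -lerBlDr; apply/bigmin_geP; split => [|k _].
    by rewrite lerBlDr (le_trans (node_dist_le _))// lerDl powR_ge0.
  rewrite lerBlDr; apply: le_trans (bigmin_le _ k _) _.
  exact: powR_dist_holder.
have := le_dist t u; have := le_dist u t; rewrite (distrC u t) => ? ?.
by rewrite ler_distl; apply/andP; split; lra.
Qed.

Lemma measurable_node_dist : measurable_fun setT (node_dist alpha x).
Proof.
rewrite /node_dist; move: (index_enum _) => s.
elim: s => [|k s IH].
  by under eq_fun do rewrite big_nil; exact: measurable_cst.
under eq_fun do rewrite big_cons; apply: measurable_minr => //.
exact: measurable_powR_dist.
Qed.

(** With [rho = pi / n], the constant [rho ^ alpha] is at most the distance plus
    the bumps [max 0 (rho ^ alpha - |t - x k| ^ alpha)], and the integral of a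
    bump over the line does not depend on the position of its node. For
    the midpoints of a uniform grid the bumps tile the period, which makes the
    bound sharp. *)
Lemma integral_node_dist_ge : (0 < n)%N ->
  ((2 * pi * (pi / n%:R) `^ alpha / (1 + alpha))%:E <=
   \int[lebesgue_measure]_(t in period_co) (node_dist alpha x t)%:E)%E.
Proof.
move=> n0.
have pi0 : 0 < pi :> R := pi_gt0 R.
have nR : 0 < n%:R :> R by rewrite ltr0n.
set rho := pi / n%:R.
have r0 : 0 < rho by rewrite divr_gt0.
have p0 : 0 < 1 + alpha by rewrite addr_gt0.
have nrho : n%:R * rho = pi by rewrite mulrC divfK// gt_eqF.
pose b k t : R := Num.max 0 (rho `^ alpha - `|t - x k| `^ alpha).
have b0 k t : 0 <= b k t by rewrite le_max lexx.
have mb k (D : set R) : measurable_fun D (fun t => (b k t)%:E).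
  apply/measurable_EFinP/measurable_funTS; apply: measurable_maxr => //.
  by apply: measurable_funB => //; exact: measurable_powR_dist.
have mJ := @measurable_period_co R.
pose B k : set R := `[(x k - rho), (x k + rho)[%classic.
have mB k : measurable (B k) by exact: measurable_itv.
have muB k : lebesgue_measure (B k) = (2 * rho)%:E.
  rewrite lebesgue_measure_itv/= lte_fin ifT; last by lra.
  by rewrite -EFinD; congr (_%:E); ring.
pose c : R := 2 * rho `^ (1 + alpha) * (alpha / (1 + alpha)).
have rhoS : rho `^ (1 + alpha) = rho * rho `^ alpha.
  rewrite powRD ?powRr1 ?ltW//.
  by rewrite (gt_eqF r0) implybT.
have ib k : (\int[lebesgue_measure]_(t in period_co) (b k t)%:E <= c%:E)%E.
  have md (D : set R) : measurable_fun D (fun t => (`|t - x k| `^ alpha)%:E).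
    by apply/measurable_EFinP/measurable_funTS; exact: measurable_powR_dist.
  have sum : (\int[lebesgue_measure]_(t in B k) (b k t)%:E +
      \int[lebesgue_measure]_(t in B k) (`|t - x k| `^ alpha)%:E =
      (rho `^ alpha * (2 * rho))%:E)%E.
    rewrite -ge0_integralD; [|exact: mB| | exact: mb| |exact: md]; last 2 first.
    - by move=> t _; rewrite lee_fin.
    - by move=> t _; rewrite lee_fin powR_ge0.
    rewrite EFinM -(muB k).
    rewrite -(integral_cst lebesgue_measure (mB k)); apply: eq_integral => t.
    rewrite inE /B/= in_itv/= => /andP[t1 t2]; rewrite -EFinD; congr (_%:E).
    rewrite /b max_r ?subrK// subr_ge0 ge0_ler_powR ?nnegrE ?(ltW r0) ?(ltW a0)//.
    by rewrite ler_distl; apply/andP; split; lra.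
  have le_B : (\int[lebesgue_measure]_(t in period_co) (b k t)%:E <=
               \int[lebesgue_measure]_(t in B k) (b k t)%:E)%E.
    apply: (@le_trans _ _ (\int[lebesgue_measure]_t (b k t)%:E)%E).
      apply: ge0_subset_integral; [exact: mJ|exact: measurableT|exact: mb| |by[]].
      by move=> t _; rewrite lee_fin.
    rewrite [leRHS]integral_mkcond le_eqVlt; apply/orP; left; apply/eqP.
    apply: eq_integral => t _; rewrite patchE; case: ifPn => //.
    rewrite notin_setE /B/= in_itv/= => /negP tB; congr (_%:E).
    rewrite /b max_l// subr_le0 ge0_ler_powR ?nnegrE ?(ltW r0) ?(ltW a0)//.
    rewrite leNgt ltr_distl; apply: contra tB => /andP[? ?].
    by apply/andP; split; lra.
  apply: (le_trans le_B); move: sum; rewrite (integral_powR_dist alpha01)//.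
  case: (integral _ _ _) => [y| |] //; rewrite -EFinD => -[] yE.
  rewrite lee_fin /c; move: yE; rewrite rhoS => yE.
  rewrite (_ : y = rho `^ alpha * (2 * rho) -
    2 * (rho * rho `^ alpha / (1 + alpha))); last by rewrite -yE addrK.
  rewrite le_eqVlt; apply/orP; left; apply/eqP; field; exact: lt0r_neq0.
have mnd (D : set R) : measurable_fun D (fun t => (node_dist alpha x t)%:E).
  by apply/measurable_EFinP/measurable_funTS; exact: measurable_node_dist.
have le_sum t : rho `^ alpha <= node_dist alpha x t + \sum_(k < n) b k t.
  have sb0 : 0 <= \sum_(k < n) b k t by exact: sumr_ge0.
  rewrite -lerBlDr; apply/bigmin_geP; split => [|k _].
    rewrite lerBlDr ler_wpDr// ge0_ler_powR ?nnegrE ?(ltW r0) ?(ltW a0)//.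
      by rewrite mulr_ge0// ltW.
    rewrite /rho ler_pdivrMr//.
    have n1 : 1 <= n%:R :> R by rewrite ler1n.
    by rewrite mulrAC ler_peMl ?ltW//; nra.
  rewrite lerBlDr (bigD1 k)//= addrA ler_wpDr//; first exact: sumr_ge0.
  by rewrite addrC -lerBlDr le_max lexx orbT.
have total : ((2 * pi * rho `^ alpha)%:E <=
    \int[lebesgue_measure]_(t in period_co) (node_dist alpha x t)%:E +
    \sum_(k < n) \int[lebesgue_measure]_(t in period_co) (b k t)%:E)%E.
  rewrite -ge0_integral_sum; [|exact: mJ|by move=> k; exact: mb|]; last first.
    by move=> k t _; rewrite lee_fin.
  rewrite -ge0_integralD; [|exact: mJ| |exact: mnd| |]; last 3 first.
  - by move=> t _; rewrite lee_fin node_dist_ge0.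
  - by move=> t _; apply: sume_ge0 => k _; rewrite lee_fin.
  - exact: (emeasurable_sum _ (fun k => mb k _)).
  have muJ : lebesgue_measure (@period_co R) = (2 * pi)%:E.
    rewrite /period_co lebesgue_measure_itv/= lte_fin ifT; last by lra.
    by rewrite sube0.
  rewrite mulrC EFinM -muJ -(integral_cst lebesgue_measure mJ).
  apply: ge0_le_integral; [exact: mJ| |exact: measurable_cst| |].
  - by move=> t _; rewrite lee_fin powR_ge0.
  - apply: emeasurable_funD; first exact: mnd.
    exact: (emeasurable_sum _ (fun k => mb k _)).
  - by move=> t _; rewrite /cst/= sumEFin -EFinD lee_fin.
have : ((2 * pi * rho `^ alpha)%:E <=
    \int[lebesgue_measure]_(t in period_co) (node_dist alpha x t)%:E +
    (n%:R * c)%:E)%E.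
  apply: (le_trans total); rewrite leeD2l//.
  apply: (@le_trans _ _ (\sum_(k < n) c%:E)%E).
    by apply: lee_sum => k _; exact: ib.
  by rewrite sumEFin sumr_const card_ord mulr_natl.
have -> : n%:R * c = 2 * pi * rho `^ alpha * (alpha / (1 + alpha)).
  by rewrite /c rhoS -nrho; ring.
have : (0 <= \int[lebesgue_measure]_(t in period_co) (node_dist alpha x t)%:E)%E.
  by apply: integral_ge0 => t _; rewrite lee_fin node_dist_ge0.
case: (integral _ _ _) => [y _|_ _|//]; last by rewrite leey.
rewrite -EFinD !lee_fin => H.
rewrite (_ : _ / _ = 2 * pi * rho `^ alpha -
  2 * pi * rho `^ alpha * (alpha / (1 + alpha))); first by lra.
by field; exact: lt0r_neq0.
Qed.

End NodeDistance.

(** * Lower bound for the error of an arbitrary formula *)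

Section LowerBound.
Context {R : realType}.
Variable lambda : R.
Hypothesis lambda01 : 0 < lambda < 1.

(** A convolution on the circle, because the marginal kernel is even. *)
Definition conv (a : R -> R) (s : R) : \bar R :=
  (\int[lebesgue_measure]_(t in period_co)
     ((a t)%:E * marginal lambda (t - s)%R))%E.

Lemma measurable_marginal_shift (D : set R) (s : R) :
  measurable_fun D (fun t : R => marginal lambda (t - s)).
Proof.
apply: measurable_funTS.
apply: (measurableT_comp (measurable_marginal lambda)).
exact: measurable_funB.
Qed.

Lemma measurable_conv_integrand (a : R -> R) (D : set R) (s : R) :
  measurable_fun setT a ->
  measurable_fun D (fun t : R => ((a t)%:E * marginal lambda (t - s)%R)%E).
Proof.
move=> ma; apply: emeasurable_funM; last exact: measurable_marginal_shift.
by apply/measurable_EFinP; exact: measurable_funTS.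
Qed.

Lemma conv_ge0 a s : (forall t, 0 <= a t) -> (0 <= conv a s)%E.
Proof.
move=> a0; apply: integral_ge0 => t _.
by rewrite mule_ge0 ?lee_fin ?marginal_ge0.
Qed.

Lemma conv_le (a : R -> R) (C s : R) : measurable_fun setT a ->
  (forall t, 0 <= a t) -> (forall t, a t <= C) -> period_itv s ->
  (conv a s <= (C * gammaK lambda)%:E)%E.
Proof.
move=> ma a0 aC Js.
have C0 : 0 <= C by apply: le_trans (a0 0) (aC 0).
rewrite EFinM (gammaKE lambda01) -(integral_marginal_shift _ Js).
rewrite -ge0_integralZl; last 4 first.
- exact: measurable_period_co.
- exact: measurable_marginal_shift.
- by move=> t _; exact: marginal_ge0.
- by rewrite lee_fin.
apply: ge0_le_integral; [exact: measurable_period_co| | | |].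
- by move=> t _; rewrite mule_ge0 ?lee_fin ?marginal_ge0.
- exact: measurable_conv_integrand.
- apply: emeasurable_funM; first exact: measurable_cst.
  exact: measurable_marginal_shift.
- by move=> t _; rewrite lee_wpmul2r ?marginal_ge0// lee_fin.
Qed.

Lemma Kop_add (a b : R -> R) (C : R) (s : R * R) : square s ->
  measurable_fun setT a -> measurable_fun setT b ->
  (forall t, 0 <= a t) -> (forall t, 0 <= b t) ->
  (forall t, a t <= C) -> (forall t, b t <= C) ->
  ((Kop lambda (fun t => a t.1 + b t.2) s)%:E = conv a s.1 + conv b s.2)%E.
Proof.
move=> Ds ma mb a0 b0 aC bC; have [s1 s2] := Ds.
rewrite /Kop /Rintegral /square /period_itv integral_rect_cc_co; last first.
  apply/measurable_EFinP; apply: measurable_funM.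
    apply: measurable_funD; first by apply: (measurableT_comp ma measurable_fst).
    by apply: (measurableT_comp mb measurable_snd).
  apply: (measurableT_comp (measurable_kern lambda)).
  by apply: measurable_fun_pair; apply: measurable_funB.
rewrite -/period_co (integral_add_kern lambda Ds ma mb a0 b0) fineK//.
rewrite ge0_fin_numE; last by rewrite adde_ge0// conv_ge0.
by rewrite lte_add_pinfty//; [apply: le_lt_trans (conv_le ma a0 aC s1) _ |
  apply: le_lt_trans (conv_le mb b0 bC s2) _]; rewrite ltry.
Qed.

(** A function is at most its supremum on average, and the mean of a
    convolution is the product of the means. *)
Lemma conv_mean_le (a : R -> R) (M : R) : measurable_fun setT a ->
  (forall t, 0 <= a t) -> (forall s, period_itv s -> (conv a s <= M%:E)%E) ->
  ((gammaK lambda)%:E * \int[lebesgue_measure]_(t in period_co) (a t)%:E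
     <= (2 * pi * M)%:E)%E.
Proof.
move=> ma a0 aM.
have p0 : 0 < pi :> R := pi_gt0 R.
have mJ := @measurable_period_co R.
pose f (z : R * R) : \bar R := ((a z.2)%:E * marginal lambda (z.2 - z.1)%R)%E.
have mf : measurable_fun setT f.
  apply: emeasurable_funM.
    by apply/measurable_EFinP; apply: (measurableT_comp ma measurable_snd).
  apply: (measurableT_comp (measurable_marginal lambda)).
  by apply: measurable_funB.
have f0 z : (0 <= f z)%E by rewrite mule_ge0 ?lee_fin ?marginal_ge0.
have [F1 F2] := @ge0_integral_rect _ _ _ _ R lebesgue_measure lebesgue_measure
    _ _ _ mJ mJ mf f0.
have muJ : lebesgue_measure (@period_co R) = (2 * pi)%:E.
  rewrite /period_co lebesgue_measure_itv/= lte_fin ifT; last by lra.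
  by rewrite sube0.
have ma' (D : set R) : measurable_fun D (fun t => (a t)%:E).
  by apply/measurable_EFinP; exact: measurable_funTS.
have -> : ((gammaK lambda)%:E *
    \int[lebesgue_measure]_(t in period_co) (a t)%:E =
    \int[lebesgue_measure]_(s in period_co) conv a s)%E.
  rewrite /conv -F1 F2 -ge0_integralZl; last 4 first.
  - exact: mJ.
  - exact: ma'.
  - by move=> t _; rewrite lee_fin.
  - by rewrite lee_fin ltW// gammaK_gt0.
  apply: eq_integral => t; rewrite inE /period_co/= in_itv/= => /andP[t0 t1].
  have Eg : (\int[lebesgue_measure]_(s in period_co) marginal lambda (t - s)%R =
      (gammaK lambda)%:E)%E.
    rewrite (gammaKE lambda01) -(@integral_marginal_shift _ lambda t); last first.
      by rewrite /period_itv/= in_itv/= t0 ltW.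
    by apply: eq_integral => s _; rewrite -marginalN opprB.
  rewrite /f/= ge0_integralZl; last 4 first.
  - exact: mJ.
  - apply: measurable_funTS.
    apply: (measurableT_comp (measurable_marginal lambda)).
    exact: measurable_funB.
  - by move=> s _; exact: marginal_ge0.
  - by rewrite lee_fin.
  by rewrite Eg muleC.
rewrite mulrC EFinM -muJ -(integral_cst lebesgue_measure mJ).
apply: ge0_le_integral; [exact: mJ| | |exact: measurable_cst|].
- by move=> s _; exact: conv_ge0.
- apply: measurable_funTS.
  exact: (@measurable_fun_inner_integral _ _ _ _ R lebesgue_measure
      _ _ mJ mf f0).
- move=> s; rewrite /period_co/= in_itv/= => /andP[s0 s1]; apply: aM.
  by rewrite /period_itv/= in_itv/= s0 ltW.
Qed.

Variable alpha : R.
Hypothesis alpha01 : 0 < alpha <= 1.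

Lemma node_dist_holder_class n1 n2 (x : 'I_n1 -> R) (y : 'I_n2 -> R) :
  holder_class alpha (fun t => node_dist alpha x t.1 + node_dist alpha y t.2).
Proof.
move=> t u _ _ /=; rewrite opprD addrACA.
by apply: le_trans (ler_normD _ _) _; rewrite lerD// node_dist_holder.
Qed.

Lemma remainder_node_dist n1 n2 (F : cubature R n1 n2 0 0) s :
  remainder lambda F (fun t => node_dist alpha (xnode F) t.1 +
                               node_dist alpha (ynode F) t.2) s =
  Kop lambda (fun t => node_dist alpha (xnode F) t.1 +
                       node_dist alpha (ynode F) t.2) s.
Proof.
rewrite /remainder big1 ?subr0// => k1 _; rewrite big1// => k2 _.
rewrite big1// => l1 _; rewrite big1// => l2 _.
by rewrite !ord1/= /mixed_deriv/= !node_dist_node// addr0 mulr0.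
Qed.

(** A function vanishing at all nodes is invisible to the formula, and its
    image under [Kop] is at least its mean somewhere. *)
Lemma class_error_ge n (F : cubature R n n 0 0) : (0 < n)%N ->
  ((2 * gammaK lambda / (1 + alpha) * (pi / n%:R) `^ alpha)%:E <=
   class_error lambda (holder_class alpha) F)%E.
Proof.
move=> n0.
have p0 : 0 < pi :> R := pi_gt0 R.
have a0 : 0 < 1 + alpha by rewrite addr_gt0//; case/andP: alpha01.
have g0 := gammaK_gt0 lambda01.
set a := node_dist alpha (xnode F); set b := node_dist alpha (ynode F).
have ma : measurable_fun setT a by exact: measurable_node_dist.
have mb : measurable_fun setT b by exact: measurable_node_dist.
have age0 t : 0 <= a t by exact: node_dist_ge0.
have bge0 t : 0 <= b t by exact: node_dist_ge0.
pose C : R := (2 * pi) `^ alpha.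
have aC t : a t <= C by exact: node_dist_le.
have bC t : b t <= C by exact: node_dist_le.
have err s : square s ->
    (conv a s.1 + conv b s.2 <= class_error lambda (holder_class alpha) F)%E.
  move=> Ds; rewrite -(Kop_add Ds ma mb age0 bge0 aC bC).
  apply: (@le_trans _ _ (ereal_sup [set (`|remainder lambda F
      (fun t => a t.1 + b t.2) s|)%:E | s in square])).
    apply: le_ereal_sup_tmp; exists (`|remainder lambda F
      (fun t => a t.1 + b t.2) s|)%:E; first by exists s.
    by rewrite remainder_node_dist lee_fin ler_norm.
  apply: ereal_sup_ubound; exists (fun t => a t.1 + b t.2) => //.
  exact: node_dist_holder_class.
have E0 : (0 <= class_error lambda (holder_class alpha) F)%E.
  apply: le_trans (err (0, 0) _); first by rewrite adde_ge0// conv_ge0.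
  by split; rewrite /period_itv/= in_itv/= lexx mulr_ge0// ltW.
case: (class_error _ _ _) E0 err => [M _ err|_ _|//]; last by rewrite leey.
pose c : R := gammaK lambda * (pi / n%:R) `^ alpha / (1 + alpha).
have mean (x : 'I_n -> R) (N : R) :
    (forall s, period_itv s -> (conv (node_dist alpha x) s <= N%:E)%E) -> c <= N.
  move=> xN.
  have := conv_mean_le (measurable_node_dist alpha x) (node_dist_ge0 alpha x) xN.
  have := integral_node_dist_ge x alpha01 n0.
  case: (integral _ _ _) => [y| |//]; last first.
    by rewrite mulry gtr0_sg// mul1e.
  rewrite -EFinM !lee_fin => Ky yN.
  have K2 : 2 * pi * c <= 2 * pi * N.
    apply: le_trans yN; rewrite /c.
    apply: le_trans (ler_wpM2l (ltW g0) Ky).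
    rewrite le_eqVlt; apply/orP; left; apply/eqP.
    by field; exact: lt0r_neq0.
  by rewrite ler_pM2l// mulr_gt0 in K2.
(* freezing one variable separates the bound on the sum into two *)
have aN s : period_itv s -> (conv a s <= (M - c)%:E)%E.
  move=> Js.
  have : (conv a s \is a fin_num).
    rewrite ge0_fin_numE ?conv_ge0//.
    by apply: le_lt_trans (conv_le ma age0 aC Js) _; rewrite ltry.
  case E: (conv a s) => [v| |] // _; rewrite lee_fin lerBrDr -lerBrDl.
  apply: (mean (ynode F)) => u Ju.
  have := err (s, u) (conj Js Ju); rewrite /= E -/b.
  by rewrite EFinB leeBrDl.
have := mean _ _ aN; rewrite lerBrDr lee_fin => cM.
apply: le_trans cM; rewrite /c le_eqVlt; apply/orP; left; apply/eqP.
by field; exact: lt0r_neq0.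
Qed.

Lemma zeta_opt_ge n : (0 < n)%N ->
  ((2 * gammaK lambda / (1 + alpha) * (pi / n%:R) `^ alpha)%:E <=
   zeta_opt lambda n n 0 0 (holder_class alpha))%E.
Proof.
by move=> n0; apply: le_ereal_inf_tmp => _ [F _ <-]; exact: class_error_ge.
Qed.

End LowerBound.

(** * Continuous approximation of the marginal kernel *)

(** The Heine-Cantor theorem, in the form where the second point may leave the
    interval. *)
Lemma segment_unif_continuous {R : realType} (g : R -> R) (a b e : R) :
  continuous g -> 0 < e -> exists2 d : R, 0 < d &
    forall u v, `[a, b]%classic u -> `|u - v| < d -> `|g u - g v| <= e.
Proof.
move=> cg e0; have := @segment_compact R a b.
move/compact_near_coveringP => /(_ R (0^'+ : set_system R)
  (fun d u => forall v, `|u - v| < d -> `|g u - g v| <= e)).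
move=> /(_ _) [].
  move=> x _; have e20 : 0 < e / 2 by rewrite divr_gt0.
  have /cvgrPdist_lt/(_ _ e20) := cg x.
  rewrite -[nbhs _]/(nbhs x) => /nbhs_ballP[r /= r0 Hr].
  have r20 : 0 < r / 2 by rewrite divr_gt0.
  have P (x' d : R) : `|x - x'| < r / 2 -> d < r / 2 ->
      forall v, `|x' - v| < d -> `|g x' - g v| <= e.
    move=> xx' dr v x'v.
    have h1 : `|g x - g x'| < e / 2.
      by apply: Hr; rewrite /ball/=; apply: lt_trans xx' _; lra.
    have h2 : `|g x - g v| < e / 2.
      apply: Hr; rewrite /ball/= -(subrK x' x) -addrA.
      by apply: le_lt_trans (ler_normD _ _) _; lra.
    rewrite -(subrK (g x) (g x')) -addrA.
    by apply: le_trans (ler_normD _ _) _; rewrite (distrC (g x')); lra.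
  exists (ball x (r / 2), [set d | d < r / 2]) => /=.
    by split; [exact: nbhsx_ballx|exact: nbhs_right_lt].
  by move=> [x' d] /= [? ?]; exact: P.
move=> d /= d0 Hd; exists (d / 2); first by rewrite divr_gt0.
move=> u v abu uv; apply: (Hd (d / 2)) => //=.
- rewrite /ball/= sub0r normrN gtr0_norm ?divr_gt0//.
  by rewrite ltr_pdivrMr// ltr_pMr// ltr1n.
- by rewrite divr_gt0.
Qed.

Section MarginalApproximation.
Context {R : realType}.
Variable lambda : R.
Hypothesis lambda01 : 0 < lambda < 1.

Definition two_periods : set R := `[(- (2 * pi))%R, (2 * pi)%R].

Lemma measurable_marginal_on (D : set R) : measurable_fun D (marginal lambda).
Proof. by apply: measurable_funTS; exact: measurable_marginal. Qed.

Lemma integral_marginal_two_periods :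
  (\int[lebesgue_measure]_(u in two_periods) marginal lambda u < +oo)%E.
Proof.
have p0 : 0 < pi :> R := pi_gt0 R.
rewrite /two_periods -integral_itv_bndo_bndc; last exact: measurable_marginal_on.
rewrite (_ : `[(- (2 * pi)), (2 * pi)[%classic =
    `[(- (2 * pi)), 0[ `|` `[0, (2 * pi)[); last first.
  by rewrite -itv_bndbnd_setU// bnd_simp ?oppr_le0 mulr_ge0// ltW.
rewrite ge0_integral_setU; [|exact: measurable_itv|exact: measurable_itv|
  exact: measurable_marginal_on|by move=> u _; exact: marginal_ge0|]; last first.
  apply/disj_setPS => x /= [].
  by rewrite !in_itv/= => /andP[_ ?] /andP[? _]; lra.
have G := integral_marginal_fin lambda01.
apply: lte_add_pinfty => //.
rewrite -(@ge0_integral_translation _ (2 * pi) _ _ (measurable_itv `[_, _[)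
  (measurable_marginal lambda) (marginal_ge0 lambda)).
rewrite (_ : _ @^-1` _ = period_co).
  under eq_integral => t _ do rewrite -marginal_period subrK.
  exact: G.
by rewrite /period_co; apply/seteqP; split => t; rewrite /= !in_itv/= => /andP[? ?];
  apply/andP; split; lra.
Qed.

(** Continuous functions are dense in the integrable functions; the marginal
    kernel, which may be infinite at the multiples of the period, is kept
    extended-real valued. *)
Lemma marginal_approx (d : R) : 0 < d -> exists g : R -> R,
  [/\ continuous g, (forall u, 0 <= g u) &
     (\int[lebesgue_measure]_(u in two_periods)
        `|marginal lambda u - (g u)%:E| <= d%:E)%E].
Proof.
move=> d0.
have mE : measurable two_periods by exact: measurable_itv.
have iE : lebesgue_measure.-integrable two_periods (marginal lambda).
  apply/integrableP; split; first exact: measurable_marginal_on.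
  under eq_integral do rewrite gee0_abs ?marginal_ge0//.
  exact: integral_marginal_two_periods.
have muE : (lebesgue_measure two_periods < +oo)%E.
  by rewrite lebesgue_measure_itv/=; case: ifPn => // _; rewrite -EFinD ltry.
have aeE : {ae @lebesgue_measure R, forall u, two_periods u ->
    marginal lambda u \is a fin_num}.
  by apply: integrable_ae iE; exact: mE.
pose k u := fine (marginal lambda u).
have k0 u : 0 <= k u by rewrite fine_ge0// marginal_ge0.
have mk (D : set R) : measurable D -> measurable_fun D k.
  move=> mD; apply: (measurableT_comp (fine_measurable measurableT)).
  exact: measurable_marginal_on.
have ik : lebesgue_measure.-integrable two_periods (EFin \o k).
  apply/integrableP; split; first by apply/measurable_EFinP; exact: mk.
  apply: le_lt_trans integral_marginal_two_periods.
  apply: ge0_le_integral; [exact: mE|by []| |exact: measurable_marginal_on|].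
    by apply: measurableT_comp => //; apply/measurable_EFinP; exact: mk.
  move=> u _; rewrite /= ger0_norm//.
  by have := marginal_ge0 lambda u; rewrite /k; case: (marginal lambda u) => //=.
have [g_ [cg _ g_cvg]] := approximation_continuous_integrable mE muE ik.
have [N _ /(_ N (leqnn N)) HN] : \forall n \near \oo,
    (\int[lebesgue_measure]_(z in two_periods) `|(k z - g_ n z)%:E| < d%:E)%E.
  have d0' : (0 < d%:E)%E by rewrite lte_fin.
  exact: (g_cvg _ (open_ereal_lt' d0')).
exists (fun u => `|g_ N u|); split.
- by move=> u; apply: continuous_comp; [exact: cg|exact: norm_continuous].
- by move=> u; exact: normr_ge0.
have mg : measurable_fun setT (g_ N) by exact: continuous_measurable_fun.
apply: le_trans (ltW HN); apply: ae_ge0_le_integral.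
- exact: mE.
- by move=> u _; exact: abse_ge0.
- apply: measurableT_comp => //; apply: emeasurable_funB.
    exact: measurable_marginal_on.
  by apply/measurable_EFinP/measurable_funTS; exact: measurableT_comp.
- by move=> u _; exact: abse_ge0.
- apply: measurableT_comp => //; apply/measurable_EFinP.
  by apply: measurable_funB; [exact: mk|exact: measurable_funTS].
move: aeE => [A [mA A0 sA]]; exists A; split => //.
apply: subset_trans sA; apply: subsetC => u /= + Eu => /(_ Eu) fu.
rewrite -(fineK fu) -EFinB /= lee_fin -/(k u).
by rewrite -{1}(ger0_norm (k0 u)) ler_dist_dist.
Qed.

End MarginalApproximation.

(** * The deviation on a uniform grid and its convolution *)

Lemma sum_indic_itv {R : realType} (u : nat -> R) (j : nat) (t : R) :
  nondecreasing_seq u ->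
  \sum_(k < j) \1_(`[u k, u k.+1[%classic) t = \1_(`[u 0, u j[%classic) t :> R.
Proof.
move=> ndu; elim: j => [|j IH].
  by rewrite big_ord0 set_itvco0 indic0.
rewrite big_ord_recr/= IH !indicE !mem_setE !in_itv/=.
have u0j : u 0 <= u j by exact: ndu.
have ujS : u j <= u j.+1 by exact: ndu.
case: (leP (u 0) t) => u0t /=; case: (ltP t (u j)) => utj /=.
- by rewrite (lt_le_trans utj ujS) addr0.
- by rewrite add0r.
- by rewrite addr0.
- by have := le_lt_trans u0j (le_lt_trans utj u0t); rewrite ltxx.
Qed.

Section Grid.
Context {R : realType}.
Variable n : nat.
Hypothesis n0 : (0 < n)%N.

(** Half-open cells, so that they partition one period. *)
Definition cell (k : nat) : set R := `[grid_pt n k, grid_pt n k.+1[.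

Lemma grid_ptE k : grid_pt n k = grid_mid n k - pi / n%:R :> R.
Proof.
rewrite /grid_mid /grid_pt -natr1; field.
by rewrite pnatr_eq0 -lt0n.
Qed.

Lemma grid_ptSE k : grid_pt n k.+1 = grid_mid n k + pi / n%:R :> R.
Proof.
rewrite /grid_mid /grid_pt -natr1; field.
by rewrite pnatr_eq0 -lt0n.
Qed.

Lemma measurable_cell k : measurable (cell k).
Proof. exact: measurable_itv. Qed.

Lemma cell_dist k (t : R) : cell k t -> `|t - grid_mid n k| <= pi / n%:R.
Proof.
rewrite /cell/= in_itv/= grid_ptE grid_ptSE => /andP[? ?].
by rewrite ler_distl; apply/andP; split; lra.
Qed.

Lemma sum_indic_cell (t : R) :
  \sum_(k < n) \1_(cell k) t = \1_period_co t :> R.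
Proof.
have nR : 0 < n%:R :> R by rewrite ltr0n.
rewrite /cell (@sum_indic_itv _ (grid_pt n)).
  have -> : grid_pt n 0 = 0 :> R by rewrite /grid_pt mulr0 !mul0r.
  by have -> : grid_pt n n = 2 * pi :> R by rewrite /grid_pt; field; rewrite gt_eqF.
move=> i j ij; rewrite /grid_pt ler_pM2r ?invr_gt0// ler_pM2r ?pi_gt0//.
by rewrite ler_pM2l// ler_nat.
Qed.

Lemma cell_sub_period (k : 'I_n) : cell k `<=` @period_co R.
Proof.
move=> t kt; have := sum_indic_cell t; rewrite (bigD1 k)//= indicE mem_set//.
rewrite [in RHS]indicE; case: (pselect (period_co t)) => // pt.
rewrite memNset//= => /eqP; rewrite paddr_eq0 ?oner_eq0//.
by apply: sumr_ge0 => i _; rewrite indicE.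
Qed.

Variable alpha : R.
Hypothesis alpha01 : 0 < alpha <= 1.

(** The largest deviation from the value at the midpoint of the cell that the
    Hoelder condition allows for functions of one variable. *)
Definition cell_dev (t : R) : R :=
  \sum_(k < n) \1_(cell k) t * `|t - grid_mid n k| `^ alpha.

Lemma cell_dev_ge0 t : 0 <= cell_dev t.
Proof. by apply: sumr_ge0 => k _; rewrite mulr_ge0 ?powR_ge0// indicE. Qed.

Lemma cell_dev_le t : cell_dev t <= (pi / n%:R) `^ alpha.
Proof.
have a0 : 0 <= alpha by case/andP: alpha01 => /ltW.
apply: (@le_trans _ _ (\sum_(k < n) \1_(cell k) t * (pi / n%:R) `^ alpha)).
  apply: ler_sum => k _; rewrite indicE; case: (pselect (cell k t)) => [kt|kt].
    rewrite mem_set// !mul1r ge0_ler_powR ?nnegrE ?divr_ge0 ?pi_ge0//.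
    exact: cell_dist.
  by rewrite memNset// !mul0r.
rewrite -mulr_suml sum_indic_cell indicE.
by rewrite -[leRHS]mul1r ler_wpM2r ?powR_ge0// lern1 leq_b1.
Qed.

Lemma measurable_cell_part k (D : set R) :
  measurable_fun D (fun t => (\1_(cell k) t * `|t - grid_mid n k| `^ alpha)%:E).
Proof.
apply/measurable_EFinP/measurable_funTS; apply: measurable_funM.
  by apply: measurable_indic; exact: measurable_cell.
exact: measurable_powR_dist.
Qed.

Lemma measurable_cell_dev : measurable_fun setT cell_dev.
Proof.
apply: measurable_sum => k; apply/measurable_EFinP; exact: measurable_cell_part.
Qed.

Lemma integral_indic_cell (k : 'I_n) (h : R -> R) :
  (\int[lebesgue_measure]_(t in period_co) (\1_(cell k) t * h t)%:E =
   \int[lebesgue_measure]_(t in cell k) (h t)%:E)%E.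
Proof.
rewrite -[cell k in RHS](setIidr (@cell_sub_period k)) integral_mkcondr.
apply: eq_integral => t _; rewrite patchE indicE.
by case: ifPn => _; rewrite ?mul1r ?mul0r.
Qed.

(** Only the mean of the deviation over a cell matters in the limit; [pi / n] is
    half the length of the cell. *)
Lemma integral_cell_part (k : 'I_n) :
  (\int[lebesgue_measure]_(t in period_co)
     (\1_(cell k) t * `|t - grid_mid n k| `^ alpha)%:E =
   ((pi / n%:R) `^ alpha / (1 + alpha))%:E *
   \int[lebesgue_measure]_(t in period_co) (\1_(cell k) t)%:E)%E.
Proof.
have p0 : 0 < pi :> R := pi_gt0 R.
have r0 : 0 < pi / n%:R :> R by rewrite divr_gt0 ?ltr0n.
have a0 : 0 < alpha by case/andP: alpha01.
rewrite integral_indic_cell.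
under [X in (_ * X)%E]eq_integral do rewrite -[\1_(cell k) _]mulr1.
rewrite (integral_indic_cell k (fun=> 1)) /cell grid_ptE grid_ptSE.
rewrite (integral_powR_dist alpha01)//.
have -> : (\int[lebesgue_measure]_(t in `[(grid_mid n k - pi / n%:R)%R,
    (grid_mid n k + pi / n%:R)%R[) 1%:E = (2 * (pi / n%:R))%:E :> \bar R)%E.
  transitivity (1%:E * lebesgue_measure
      (`[(grid_mid n k - pi / n%:R)%R, (grid_mid n k + pi / n%:R)%R[ : set R))%E.
    by apply: integral_cst; exact: measurable_itv.
  rewrite mul1e lebesgue_measure_itv/= lte_fin ifT; last by lra.
  by rewrite -EFinD; congr (_%:E); ring.
rewrite -EFinM; congr (_%:E).
rewrite powRD ?(gt_eqF r0) ?implybT// powRr1 ?(ltW r0)//.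
move: (pi / n%:R) (_ `^ alpha) => r ra; ring.
Qed.

End Grid.

Section Fejer.
Context {R : realType}.
Variables lambda alpha : R.
Hypothesis lambda01 : 0 < lambda < 1.
Hypothesis alpha01 : 0 < alpha <= 1.

(** The deviation oscillates with period [2 pi / n], so that only its mean counts
    in the limit, uniformly in [s]: on each cell a continuous approximation of the
    kernel is almost constant. *)
Lemma conv_cell_dev_le (e : R) : 0 < e -> exists2 N : nat, (0 < N)%N &
  forall n, (N <= n)%N -> forall s, period_itv s ->
  (conv lambda (cell_dev n alpha) s <=
   ((gammaK lambda / (1 + alpha) + e) * (pi / n%:R) `^ alpha)%:E)%E.
Proof.
move=> e0.
have p0 : 0 < pi :> R := pi_gt0 R.
have a0 : 0 < alpha by case/andP: alpha01.
have a1 : 1 <= 1 + alpha by rewrite lerDl ltW.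
(* the contributions of [d] below add up to [d * (2 + 4 * pi)] at most *)
pose d := e / (2 + 4 * pi).
have dp : 0 < 2 + 4 * pi :> R by rewrite addr_gt0// mulr_gt0.
have d0 : 0 < d by rewrite divr_gt0.
have [g [cg g0 gd]] := marginal_approx lambda01 d0.
have [w w0 gw] := segment_unif_continuous (- (2 * pi)) (2 * pi) cg d0.
have pw : 0 < w / pi by rewrite divr_gt0.
have [N] := ltr_add_invr pw; rewrite add0r => Nw.
exists N.+1 => // n Nn s Js.
have n0 : (0 < n)%N by exact: leq_trans Nn.
have nR : 0 < n%:R :> R by rewrite ltr0n.
set r := pi / n%:R.
have r0 : 0 < r by rewrite divr_gt0.
have rw : r < w.
  rewrite /r mulrC -ltr_pdivlMr//; apply: le_lt_trans Nw.
  by rewrite lef_pV2 ?posrE// ler_nat.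
set ra := r `^ alpha.
have ra0 : 0 <= ra by exact: powR_ge0.
pose m := ra / (1 + alpha).
have m0 : 0 <= m by rewrite divr_ge0// (le_trans ler01).
have mJ := @measurable_period_co R.
pose D u := (`|marginal lambda u - (g u)%:E|)%E.
have D0 u : (0 <= D u)%E by exact: abse_ge0.
have mg : measurable_fun setT g by exact: continuous_measurable_fun.
have mD : measurable_fun setT D.
  apply: measurableT_comp => //; apply: emeasurable_funB.
    exact: measurable_marginal.
  exact/measurable_EFinP.
have mgs (A : set R) : measurable_fun A (fun t => (g (t - s))%:E).
  apply/measurable_EFinP/measurable_funTS; apply: (measurableT_comp mg).
  exact: measurable_funB.
have mDs (A : set R) : measurable_fun A (fun t : R => D (t - s)%R).
  apply: measurable_funTS; apply: (measurableT_comp mD).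
  exact: measurable_funB.
have [s0 s1] : 0 <= s /\ s <= 2 * pi.
  by move: Js; rewrite /period_itv/= in_itv/= => /andP.
have JE t : period_co t -> `[(- (2 * pi)), (2 * pi)]%classic (t - s).
  by rewrite /period_co/= !in_itv/= => /andP[? ?]; apply/andP; split; lra.
have leD u : (marginal lambda u <= (g u)%:E + D u)%E.
  rewrite /D; have := marginal_ge0 lambda u.
  case: (marginal lambda u) => [v _|_|//] /=; last by rewrite leey.
  rewrite -EFinD !lee_fin.
  by rewrite -lerBlDl ler_norm.
have leD' u : ((g u)%:E <= marginal lambda u + D u)%E.
  rewrite /D; have := marginal_ge0 lambda u.
  case: (marginal lambda u) => [v _|_|//] /=; last by rewrite leey.
  rewrite -EFinD !lee_fin.
  by rewrite -lerBlDl distrC ler_norm.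
have intD : (\int[lebesgue_measure]_(t in period_co) D (t - s)%R <= d%:E)%E.
  apply: le_trans gd.
  pose S : set R := `[(- s)%R, (2 * pi - s)%R[%classic.
  have -> : period_co = (fun t : R => t - s) @^-1` S.
    apply/seteqP; split => x; rewrite /S/period_co/= !in_itv/=;
    by move=> /andP[? ?]; apply/andP; split; lra.
  rewrite (ge0_integral_translation s (measurable_itv `[_, _[) mD D0).
  apply: ge0_subset_integral; [exact: measurable_itv|exact: measurable_itv| | |].
  - exact: measurable_funTS.
  - by move=> t _; exact: D0.
  - move=> t; rewrite /S/two_periods/= !in_itv/= => /andP[? ?].
    by apply/andP; split; lra.
have intg : (\int[lebesgue_measure]_(t in period_co) (g (t - s))%:E <=
    (gammaK lambda + d)%:E)%E.
  apply: (@le_trans _ _ (\int[lebesgue_measure]_(t in period_co)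
      (marginal lambda (t - s)%R + D (t - s)%R))%E).
    apply: ge0_le_integral; [exact: mJ| |exact: mgs| |].
    - by move=> t _; rewrite lee_fin.
    - by apply: emeasurable_funD; [exact: measurable_marginal_shift|exact: mDs].
    - by move=> t _; exact: leD'.
  rewrite ge0_integralD; [|exact: mJ|by move=> t _; exact: marginal_ge0|
    exact: measurable_marginal_shift|by move=> t _; exact: D0|exact: mDs].
  by rewrite integral_marginal_shift// -(gammaKE lambda01) EFinD leeD2l.
have dev0 := @cell_dev_ge0 R n alpha.
have mdev (A : set R) : measurable_fun A (fun t => (cell_dev n alpha t)%:E).
  by apply/measurable_EFinP/measurable_funTS; exact: measurable_cell_dev.
have part2 : (\int[lebesgue_measure]_(t in period_co)
    ((cell_dev n alpha t)%:E * D (t - s)%R) <= (ra * d)%:E)%E.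
  apply: (@le_trans _ _ (ra%:E * \int[lebesgue_measure]_(t in period_co)
    D (t - s)%R)%E); last first.
    by rewrite EFinM lee_wpmul2l// lee_fin.
  rewrite -ge0_integralZl; last 4 first.
  - exact: mJ.
  - exact: mDs.
  - by move=> t _; exact: D0.
  - by rewrite lee_fin.
  apply: ge0_le_integral; [exact: mJ| | | |].
  - by move=> t _; rewrite mule_ge0// lee_fin.
  - by apply: emeasurable_funM; [exact: mdev|exact: mDs].
  - by apply: emeasurable_funM; [exact: measurable_cst|exact: mDs].
  - by move=> t _; rewrite lee_wpmul2r// lee_fin cell_dev_le.
pose v (k : 'I_n) := g (grid_mid n k - s) + d.
have v0 k : 0 <= v k by rewrite addr_ge0// ltW.
have gv (k : 'I_n) t : cell n k t -> `|g (t - s) - g (grid_mid n k - s)| <= d.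
  move=> kt; apply: gw; first exact/JE/(cell_sub_period n0 kt).
  by rewrite opprB addrA subrK; apply: le_lt_trans (cell_dist n0 kt) rw.
have mic (k : 'I_n) (A : set R) :
    measurable_fun A (fun t => (\1_(cell n k) t)%:E : \bar R).
  apply/measurable_EFinP/measurable_funTS/measurable_indic.
  exact: measurable_cell.
have mcp (k : 'I_n) (A : set R) : measurable_fun A
    (fun t => (\1_(cell n k) t * `|t - grid_mid n k| `^ alpha)%:E : \bar R).
  exact: measurable_cell_part.
have ind0 (k : 'I_n) t : 0 <= \1_(cell n k) t :> R by rewrite indicE ler0n.
have part1 : (\int[lebesgue_measure]_(t in period_co)
    ((cell_dev n alpha t)%:E * (g (t - s))%:E) <=
    (m * (gammaK lambda + d + 2 * d * (2 * pi)))%:E)%E.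
  apply: (@le_trans _ _ (\int[lebesgue_measure]_(t in period_co)
      (\sum_(k < n) (v k)%:E *
         (\1_(cell n k) t * `|t - grid_mid n k| `^ alpha)%:E))%E).
    apply: ge0_le_integral; [exact: mJ| | | |].
    - by move=> t _; rewrite mule_ge0 ?lee_fin.
    - by apply: emeasurable_funM; [exact: mdev|exact: mgs].
    - apply: emeasurable_sum => k.
      by apply: emeasurable_funM;
        [exact: measurable_cst|exact: measurable_cell_part].
    - move=> t _; rewrite -EFinM.
      under [leRHS]eq_bigr do rewrite -EFinM.
      rewrite sumEFin lee_fin /cell_dev mulr_suml; apply: ler_sum => k _.
      rewrite indicE; case: (pselect (cell n k t)) => kt; last first.
        by rewrite memNset// !mul0r mulr0.
      rewrite mem_set// mul1r mulrC ler_wpM2r ?powR_ge0//.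
      by have := gv k t kt; rewrite ler_distl => /andP[].
  rewrite ge0_integral_sum; [|exact: mJ| |]; last 2 first.
  - move=> k; apply: emeasurable_funM; first exact: measurable_cst.
    exact: measurable_cell_part.
  - by move=> k t _; apply: mule_ge0; rewrite lee_fin// mulr_ge0 ?powR_ge0.
  have -> : (\sum_(k < n) \int[lebesgue_measure]_(t in period_co) ((v k)%:E *
      (\1_(cell n k) t * `|t - grid_mid n k| `^ alpha)%:E) =
      m%:E * \int[lebesgue_measure]_(t in period_co)
        (\sum_(k < n) (v k)%:E * (\1_(cell n k) t)%:E))%E.
    rewrite ge0_integral_sum; [|exact: mJ| |]; last 2 first.
    - move=> k; apply: emeasurable_funM; first exact: measurable_cst.
      exact: mic.
    - by move=> k t _; apply: mule_ge0; rewrite lee_fin.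
    rewrite ge0_sume_distrr; last first.
      move=> k _; apply: integral_ge0 => t _.
      by apply: mule_ge0; rewrite lee_fin.
    apply: eq_bigr => k _.
    rewrite ge0_integralZl; last 4 first.
    - exact: mJ.
    - exact: (mic k).
    - by move=> t _; rewrite lee_fin.
    - by rewrite lee_fin.
    rewrite ge0_integralZl; last 4 first.
    - exact: mJ.
    - exact: (mcp k).
    - by move=> t _; rewrite lee_fin mulr_ge0 ?powR_ge0.
    - by rewrite lee_fin.
    by rewrite (integral_cell_part n0 alpha01) -/r -/ra -/m muleCA.
  rewrite [leRHS]EFinM lee_wpmul2l ?lee_fin//.
  apply: (@le_trans _ _ (\int[lebesgue_measure]_(t in period_co)
      ((g (t - s))%:E + (2 * d)%:E))%E).
    apply: ge0_le_integral; [exact: mJ| | | |].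
    - move=> t _; apply: sume_ge0 => k _.
      by apply: mule_ge0; rewrite lee_fin.
    - apply: emeasurable_sum => k.
      by apply: emeasurable_funM; [exact: measurable_cst|exact: mic].
    - by apply: emeasurable_funD; [exact: mgs|exact: measurable_cst].
    - move=> t Jt; under eq_bigr do rewrite -EFinM.
      rewrite sumEFin -EFinD lee_fin.
      apply: (@le_trans _ _ (\sum_(k < n) \1_(cell n k) t * (g (t - s) + 2 * d))).
        apply: ler_sum => k _; rewrite mulrC.
        rewrite indicE; case: (pselect (cell n k t)) => kt; last first.
          by rewrite memNset// !mul0r.
        rewrite mem_set// !mul1r /v.
        by have := gv k t kt; rewrite ler_distl => /andP[? _]; lra.
      by rewrite -mulr_suml (sum_indic_cell n0) indicE mem_set// mul1r.
  rewrite ge0_integralD; [|exact: mJ|by move=> t _; rewrite lee_fin|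
    exact: mgs| |exact: measurable_cst]; last first.
    by move=> t _; rewrite lee_fin mulr_ge0// ltW.
  rewrite [X in (_ + X)%E](_ : _ = (2 * d * (2 * pi))%:E) ?EFinD ?leeD2r//.
  transitivity ((2 * d)%:E * lebesgue_measure (@period_co R))%E.
    exact: integral_cst.
  rewrite /period_co lebesgue_measure_itv/= lte_fin ifT; last by lra.
  by rewrite sube0 -EFinM.
rewrite /conv; apply: (@le_trans _ _ (\int[lebesgue_measure]_(t in period_co)
   ((cell_dev n alpha t)%:E * (g (t - s))%:E +
    (cell_dev n alpha t)%:E * D (t - s)%R))%E).
  apply: ge0_le_integral; [exact: mJ| | | |].
  - by move=> t _; rewrite mule_ge0 ?lee_fin ?marginal_ge0.
  - apply: emeasurable_funM; first exact: mdev.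
    exact: measurable_marginal_shift.
  - apply: emeasurable_funD.
    + by apply: emeasurable_funM; [exact: mdev|exact: mgs].
    + by apply: emeasurable_funM; [exact: mdev|exact: mDs].
  - by move=> t _; rewrite -ge0_muleDr ?lee_fin// lee_wpmul2l ?lee_fin.
rewrite ge0_integralD; [|exact: mJ| | | |]; last 4 first.
- by move=> t _; rewrite mule_ge0// lee_fin.
- by apply: emeasurable_funM; [exact: mdev|exact: mgs].
- by move=> t _; rewrite mule_ge0// lee_fin.
- by apply: emeasurable_funM; [exact: mdev|exact: mDs].
apply: le_trans (leeD part1 part2) _; rewrite -EFinD lee_fin.
have m_ra : m * (1 + alpha) = ra by rewrite divfK// gt_eqF// (lt_le_trans ltr01).
have m_le : m <= ra by rewrite /m ler_pdivrMr ?(lt_le_trans ltr01)// ler_peMr.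
have -> : (gammaK lambda / (1 + alpha) + e) * ra = gammaK lambda * m + e * ra.
  by rewrite /m; ring.
have -> : e = d * (2 + 4 * pi) by rewrite divfK// gt_eqF.
have : m * (d * (1 + 4 * pi)) <= ra * (d * (1 + 4 * pi)).
  by rewrite ler_wpM2r// mulr_ge0 ?(ltW d0)// addr_ge0// mulr_ge0// ltW.
by move: (gammaK lambda) pi => G q; lra.
Qed.

End Fejer.

(** * Upper bound for the remainder of the midpoint formula *)

Section HolderClass.
Context {R : realType}.
Variable alpha : R.
Hypothesis alpha01 : 0 < alpha <= 1.
Let a0 : 0 < alpha. Proof. by case/andP: alpha01. Qed.

Lemma measurable_square : measurable (@square R).
Proof. by apply: measurableX; exact: measurable_itv. Qed.

(** One more cell covers the right end point of the period. *)
Lemma sum_indic_cell_succ (n : nat) (t : R) : (0 < n)%N -> period_itv t ->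
  \sum_(k < n.+1) \1_(cell n k) t = 1 :> R.
Proof.
move=> n0; rewrite /period_itv/= in_itv/= => /andP[t0 t1].
have nR : 0 < n%:R :> R by rewrite ltr0n.
have p0 : 0 < pi :> R := pi_gt0 R.
rewrite /cell (@sum_indic_itv _ (grid_pt n)); last first.
  move=> i j ij; rewrite /grid_pt ler_pM2r ?invr_gt0// ler_pM2r//.
  by rewrite ler_pM2l// ler_nat.
rewrite indicE mem_set//= in_itv/= /grid_pt mulr0 !mul0r t0/=.
apply: le_lt_trans t1 _; rewrite ltr_pdivlMr// mulrAC ltr_pM2r// ltr_pM2l//.
by rewrite ltr_nat.
Qed.

(** A function of the class is the limit, on the square, of step functions on
    the grids, hence measurable there. *)
Lemma holder_class_measurable (f : R * R -> R) :
  holder_class alpha f -> measurable_fun square f.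
Proof.
move=> hf.
have p0 : 0 < pi :> R := pi_gt0 R.
pose S n (t : R * R) : R := \sum_(k < n.+2) \sum_(l < n.+2)
  \1_(cell n.+1 k) t.1 * \1_(cell n.+1 l) t.2 *
    f (grid_pt n.+1 k, grid_pt n.+1 l).
have mS n : measurable_fun square (S n).
  apply: measurable_funTS; apply: measurable_sum => k.
  apply: measurable_sum => l; apply: measurable_funM => //.
  apply: measurable_funM.
    apply: (measurableT_comp _ measurable_fst); apply: measurable_indic.
    exact: measurable_cell.
  apply: (measurableT_comp _ measurable_snd); apply: measurable_indic.
  exact: measurable_cell.
have fS n t : square t -> `|f t - S n t| <= 2 * (2 * pi / n.+1%:R) `^ alpha.
  move=> [t1 t2]; set h := (2 * pi / n.+1%:R) `^ alpha.
  have fE : f t = \sum_(k < n.+2) \sum_(l < n.+2)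
      \1_(cell n.+1 k) t.1 * \1_(cell n.+1 l) t.2 * f t.
    under eq_bigr do rewrite -mulr_suml -mulr_sumr
      (sum_indic_cell_succ _ t2)// mulr1.
    by rewrite -mulr_suml (sum_indic_cell_succ _ t1)// mul1r.
  have hE : 2 * h = \sum_(k < n.+2) \sum_(l < n.+2)
      \1_(cell n.+1 k) t.1 * \1_(cell n.+1 l) t.2 * (2 * h).
    under eq_bigr do rewrite -mulr_suml -mulr_sumr
      (sum_indic_cell_succ _ t2)// mulr1.
    by rewrite -mulr_suml (sum_indic_cell_succ _ t1)// mul1r.
  have cellh (x : R) k : cell n.+1 k x -> `|x - grid_pt n.+1 k| `^ alpha <= h.
    move=> xk; rewrite ge0_ler_powR ?nnegrE ?(ltW a0)//.
      by rewrite divr_ge0// mulr_ge0// ltW.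
    have := cell_dist (ltn0Sn n) xk; rewrite grid_ptE//.
    rewrite ler_distl => /andP[h1 h2].
    have -> : 2 * pi / n.+1%:R = 2 * (pi / n.+1%:R) :> R by rewrite mulrA.
    have r0 : 0 <= pi / n.+1%:R :> R by rewrite divr_ge0// ltW.
    rewrite ler_distl; move: (pi / _) (grid_mid _ _) r0 h1 h2 => r m r0 h1 h2.
    by clear -r0 h1 h2; apply/andP; split; lra.
  rewrite [X in `|X - _|]fE /S -sumrB hE; apply: le_trans (ler_norm_sum _ _ _) _.
  apply: ler_sum => k _; rewrite -sumrB; apply: le_trans (ler_norm_sum _ _ _) _.
  apply: ler_sum => l _; rewrite -mulrBr !indicE.
  case: (pselect (cell n.+1 k t.1)) => tk; last by rewrite memNset// !mul0r normr0.
  case: (pselect (cell n.+1 l t.2)) => tl; last first.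
    by rewrite (memNset tl) mulr0 !mul0r normr0.
  rewrite !mem_set// !mul1r.
  have gk : period_itv (grid_pt n.+1 k : R) by apply: grid_pt_itv; rewrite -ltnS.
  have gl : period_itv (grid_pt n.+1 l : R) by apply: grid_pt_itv; rewrite -ltnS.
  apply: le_trans (hf t (_, _) (conj t1 t2) (conj gk gl)) _.
  by rewrite [leRHS]mulr_natl mulr2n lerD// cellh.
apply: (measurable_fun_cvg mS) => t Dt.
apply/cvgrPdist_le => e e0.
pose c : R := (e / 2) `^ (alpha^-1).
have c0 : 0 < c by rewrite powR_gt0// divr_gt0.
have [N] : exists N : nat, N.+1%:R^-1 < c / (2 * pi).
  have c1 : 0 < c / (2 * pi) by rewrite divr_gt0// mulr_gt0.
  by have [N] := ltr_add_invr c1; rewrite add0r; exists N.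
move=> Nc; exists N => // n /= Nn; apply: le_trans (fS n t Dt) _.
rewrite mulrC -ler_pdivlMr//.
have -> : e / 2 = c `^ alpha.
  by rewrite /c -powRrM mulVf ?gt_eqF// powRr1// divr_ge0// ltW.
rewrite ge0_ler_powR ?nnegrE ?(ltW a0) ?(ltW c0)//.
  by rewrite divr_ge0// mulr_ge0// ltW.
rewrite mulrC -ler_pdivlMr ?mulr_gt0//; apply: le_trans (ltW Nc).
by rewrite lef_pV2 ?posrE// ler_nat.
Qed.

Lemma holder_class_bounded (f : R * R -> R) : holder_class alpha f ->
  forall t, square t -> `|f t| <= `|f (0, 0)| + 2 * (2 * pi) `^ alpha.
Proof.
move=> hf t Dt; have p0 : 0 < pi :> R := pi_gt0 R.
have D0 : square ((0, 0) : R * R).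
  by split; rewrite /period_itv/= in_itv/= lexx mulr_ge0// ltW.
rewrite -[f t](subrK (f (0, 0))) addrC; apply: le_trans (ler_normD _ _) _.
rewrite lerD2l; apply: le_trans (hf _ _ Dt D0) _; rewrite /= !subr0.
case: Dt; rewrite /period_itv/= !in_itv/= => /andP[x0 x1] /andP[y0 y1].
have p20 : 0 <= 2 * pi :> R by rewrite mulr_ge0// ltW.
rewrite mulr_natl mulr2n lerD// ge0_ler_powR ?nnegrE ?(ltW a0)//.
- by rewrite ger0_norm.
- by rewrite ger0_norm.
Qed.

End HolderClass.

Section UpperBound.
Context {R : realType}.
Variables lambda alpha : R.
Hypothesis lambda01 : 0 < lambda < 1.
Hypothesis alpha01 : 0 < alpha <= 1.
Variable n : nat.
Hypothesis n0 : (0 < n)%N.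
Variable s : R * R.
Hypothesis Ds : square s.

Let Q : set (R * R) := period_co `*` period_co.
Let K (t : R * R) : R := kern lambda (t.1 - s.1, t.2 - s.2).

Let mQ : measurable Q.
Proof. by apply: measurableX; exact: measurable_period_co. Qed.

Let QD : Q `<=` square.
Proof.
move=> t []; rewrite /period_co/= !in_itv/= => /andP[? ?] /andP[? ?]; split;
  by rewrite /period_itv/= in_itv/=; apply/andP; split => //; exact: ltW.
Qed.

Let K0 t : 0 <= K t. Proof. exact: kern_ge0. Qed.

Let mK : measurable_fun setT K.
Proof.
apply: (measurableT_comp (measurable_kern lambda)).
by apply: measurable_fun_pair; apply: measurable_funB.
Qed.

Let iK : leb2.-integrable Q (EFin \o K).
Proof.
apply/integrableP; split; first by apply/measurable_EFinP; exact: measurable_funTS.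
have := @integral_add_kern R lambda (cst 1) (cst 0) s Ds (measurable_cst _)
  (measurable_cst _) (fun=> ler01) (fun=> lexx _).
have -> : (\int[leb2]_(t in Q) `|(EFin \o K) t| =
    \int[leb2]_(t in Q) ((cst 1 t.1 + cst 0 t.2) *
      kern lambda (t.1 - s.1, t.2 - s.2))%:E)%E.
  by apply: eq_integral => t _; rewrite /= addr0 mul1r ger0_norm.
move=> ->; have [s1 s2] := Ds.
have c1 := @conv_le R lambda lambda01 (cst 1) 1 s.1 (measurable_cst _)
  (fun=> ler01) (fun=> lexx _) s1.
have c2 := @conv_le R lambda lambda01 (cst 0) 0 s.2 (measurable_cst _)
  (fun=> lexx _) (fun=> lexx _) s2.
by rewrite lte_add_pinfty//; [apply: le_lt_trans c1 _|apply: le_lt_trans c2 _];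
  rewrite ltry.
Qed.

Let integrable_mulK (h : R * R -> R) (C : R) : measurable_fun Q h ->
  (forall t, Q t -> `|h t| <= C) -> leb2.-integrable Q (EFin \o (h \* K)).
Proof.
move=> mh hC.
have iC : leb2.-integrable Q (fun t => C%:E * (EFin \o K) t)%E.
  by apply: integrableZl; [exact: mQ|exact: iK].
apply: le_integrable iC; first exact: mQ.
- by apply/measurable_EFinP/measurable_funM => //; exact: measurable_funTS.
- move=> t Qt; rewrite /= lee_fin !normrM ler_wpM2r//.
  exact: le_trans (hC t Qt) (ler_norm _).
Qed.

Let ind (k l : nat) (t : R * R) : R := \1_(cell n k) t.1 * \1_(cell n l) t.2.

Let mind k l (D : set (R * R)) : measurable_fun D (ind k l).
Proof.
apply: measurable_funTS; apply: measurable_funM.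
  apply: (measurableT_comp _ measurable_fst); apply: measurable_indic.
  exact: measurable_cell.
apply: (measurableT_comp _ measurable_snd); apply: measurable_indic.
exact: measurable_cell.
Qed.

Let ind0 k l t : 0 <= ind k l t.
Proof. by rewrite mulr_ge0// indicE ler0n. Qed.

Let ind1 k l t : `|ind k l t| <= 1.
Proof.
rewrite ger0_norm// /ind !indicE.
by apply: mulr_ile1; rewrite ?ler0n// lern1 leq_b1.
Qed.

Let sum_ind t : Q t -> \sum_(k < n) \sum_(l < n) ind k l t = 1.
Proof.
move=> [t1 t2]; under eq_bigr do rewrite -mulr_sumr sum_indic_cell//.
by rewrite -mulr_suml sum_indic_cell// !indicE !mem_set// mulr1.
Qed.

Let sum_indM t c : Q t -> c = \sum_(k < n) \sum_(l < n) ind k l t * c.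
Proof.
move=> Qt; under eq_bigr do rewrite -mulr_suml.
by rewrite -mulr_suml (sum_ind Qt) mul1r.
Qed.

(** The closed cells of the formula can be replaced by half-open ones, which
    do not overlap, because their boundaries are negligible. *)
Let coefE (k l : 'I_n) i j :
  (coef (midpoint_cubature lambda n) k l i j s)%:E =
  (\int[leb2]_(t in Q) (ind k l t * K t)%:E)%E.
Proof.
rewrite /=/Rintegral /grid_cell integral_rect_cc_co; last first.
  by apply/measurable_EFinP.
rewrite -/(cell n k) -/(cell n l).
have -> : (\int[leb2]_(t in cell n k `*` cell n l)
      (kern lambda (t.1 - s.1, t.2 - s.2))%:E =
    \int[leb2]_(t in Q) (ind k l t * K t)%:E)%E.
  have -> : cell n k `*` cell n l = Q `&` (cell n k `*` cell n l).
    apply/seteqP; split; last by move=> ? [].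
    move=> t [t1 t2]; split=> //; split; [exact: (cell_sub_period n0 t1)|
      exact: (cell_sub_period n0 t2)].
  rewrite integral_mkcondr; apply: eq_integral => t _.
  rewrite patchE in_setX /ind !indicE.
  by case: (t.1 \in _); case: (t.2 \in _); rewrite /= ?mul1r ?mul0r.
rewrite fineK//; apply: integrable_fin_num => //.
exact: (@integrable_mulK (ind k l) 1).
Qed.

Let step (f : R * R -> R) (t : R * R) : R :=
  \sum_(k < n) \sum_(l < n) ind k l t * f (grid_mid n k, grid_mid n l).

(** Hence the remainder is the integral of [f - step f] against the kernel. *)
Let formulaE f :
  (\sum_(k1 < n) \sum_(k2 < n) \sum_(l1 < 1) \sum_(l2 < 1)
    coef (midpoint_cubature lambda n) k1 k2 l1 l2 s * mixed_deriv l1 l2 f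
      (xnode (midpoint_cubature lambda n) k1,
       ynode (midpoint_cubature lambda n) k2))%:E =
  (\int[leb2]_(t in Q) (step f t * K t)%:E)%E.
Proof.
have i2 (k l : 'I_n) : leb2.-integrable Q (fun t =>
    ((f (grid_mid n k, grid_mid n l))%:E * (ind k l t * K t)%:E)%E).
  by apply: integrableZl => //; exact: (@integrable_mulK (ind k l) 1).
transitivity (\int[leb2]_(t in Q) (\sum_(k < n) \sum_(l < n)
    (f (grid_mid n k, grid_mid n l))%:E * (ind k l t * K t)%:E))%E; last first.
  apply: eq_integral => t _.
  rewrite /step mulr_suml -sumEFin; apply: eq_bigr => k _.
  rewrite mulr_suml -sumEFin; apply: eq_bigr => l _.
  by rewrite -EFinM; congr (_%:E); ring.
rewrite integral_sum//; last first.
  by move=> k; exact: integrable_sum.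
rewrite -sumEFin; apply: eq_bigr => k _.
rewrite integral_sum//.
rewrite -sumEFin; apply: eq_bigr => l _.
rewrite integralZl//; last exact: (@integrable_mulK (ind k l) 1).
by rewrite big_ord1 big_ord1 EFinM coefE muleC.
Qed.

(** On the cell with indices [k] and [l] the Hoelder condition bounds [f - step f]
    by the sum of the deviations in the two variables. *)
Lemma remainder_midpoint_le f : holder_class alpha f ->
  ((`|remainder lambda (midpoint_cubature lambda n) f s|)%:E <=
   conv lambda (cell_dev n alpha) s.1 + conv lambda (cell_dev n alpha) s.2)%E.
Proof.
move=> hf.
have mf := holder_class_measurable alpha01 hf.
have fC := holder_class_bounded alpha01 hf.
have mfQ : measurable_fun Q f := measurable_funS measurable_square QD mf.
have ifK : leb2.-integrable Q (EFin \o (f \* K)).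
  by apply: integrable_mulK mfQ _ => t /QD; exact: fC.
have mstep : measurable_fun Q (step f).
  by apply: measurable_sum => k; apply: measurable_sum => l; exact: measurable_funM.
have stepC t : Q t -> `|step f t| <= `|f (0, 0)| + 2 * (2 * pi) `^ alpha.
  move=> Qt; apply: le_trans (ler_norm_sum _ _ _) _.
  rewrite [leRHS](sum_indM _ Qt); apply: ler_sum => k _.
  apply: le_trans (ler_norm_sum _ _ _) _; apply: ler_sum => l _.
  rewrite normrM ger0_norm// ler_wpM2l//; apply: fC.
  by split; exact: grid_mid_itv.
have isK := integrable_mulK mstep stepC.
have KopE : (Kop lambda f s)%:E = (\int[leb2]_(t in Q) (f t * K t)%:E)%E.
  pose g : R * R -> \bar R := (EFin \o (f \* K)) \_ square.
  have mp : measurable_fun setT g.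
    have /measurable_EFinP mfK : measurable_fun square (f \* K).
      by apply: (measurable_funM mf); exact: measurable_funTS.
    exact: (measurable_restrictT _ measurable_square).1 mfK.
  rewrite /Kop /Rintegral.
  have -> : (\int[leb2]_(t in square)
        (f t * kern lambda (t.1 - s.1, t.2 - s.2))%:E =
      \int[leb2]_(t in square) g t)%E.
    by apply: eq_integral => t tD; rewrite /g patchE tD.
  have -> : (\int[leb2]_(t in square) g t =
      \int[leb2]_(t in Q) g t)%E.
    exact: integral_rect_cc_co.
  have -> : (\int[leb2]_(t in Q) g t =
      \int[leb2]_(t in Q) (f t * K t)%:E)%E.
    apply: eq_integral => t; rewrite inE => /QD tD; rewrite /g patchE mem_set//.
  by rewrite fineK//; exact: integrable_fin_num.
rewrite /remainder -abse_EFin EFinB KopE formulaE.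
rewrite -integralB_EFin//.
have mdev := @measurable_cell_dev R n alpha.
have dev0 := @cell_dev_ge0 R n alpha.
rewrite -(integral_add_kern lambda Ds mdev mdev dev0 dev0).
have mdiff : measurable_fun Q
    (fun t => (f t * K t)%:E - (step f t * K t)%:E : \bar R)%E.
  by apply: emeasurable_funB; apply/measurable_EFinP; apply: measurable_funM => //;
    exact: measurable_funTS.
apply: (@le_trans _ _ (\int[leb2]_(t in Q)
    `|(f t * K t)%:E - (step f t * K t)%:E|)%E).
  by apply: le_abse_integral; [exact: mQ|exact: mdiff].
apply: ge0_le_integral; [exact: mQ| | | |].
- by move=> t _; exact: abse_ge0.
- by apply: measurableT_comp => //; exact: mdiff.
- apply/measurable_EFinP/measurable_funTS/measurable_funM => //.
  by apply: measurable_funD; [exact: (measurableT_comp mdev measurable_fst)|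
    exact: (measurableT_comp mdev measurable_snd)].
move=> t Qt; rewrite -EFinB /= lee_fin -/(K t) -mulrBl normrM (ger0_norm (K0 t)).
rewrite ler_wpM2r//.
have Dt := QD Qt; have [t1 t2] := Qt.
rewrite (sum_indM (f t) Qt).
(* each partition of unity is inserted in the deviation of the other variable *)
have -> : cell_dev n alpha t.1 + cell_dev n alpha t.2 =
    \sum_(k < n) \sum_(l < n) ind k l t *
      (`|t.1 - grid_mid n k| `^ alpha + `|t.2 - grid_mid n l| `^ alpha).
  have S1 := @sum_indic_cell R n n0 t.1; have S2 := @sum_indic_cell R n n0 t.2.
  rewrite !indicE !mem_set// in S1 S2.
  under [RHS]eq_bigr do under eq_bigr do rewrite mulrDr.
  under [RHS]eq_bigr do rewrite big_split/=.
  rewrite big_split/=; congr (_ + _).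
    apply: eq_bigr => k _; rewrite /ind -mulr_suml -mulr_sumr S2 mulr1.
    by [].
  rewrite exchange_big/=; apply: eq_bigr => l _.
  by rewrite /ind -mulr_suml -mulr_suml S1 mul1r.
rewrite /step -sumrB; apply: le_trans (ler_norm_sum _ _ _) _.
apply: ler_sum => k _; rewrite -sumrB; apply: le_trans (ler_norm_sum _ _ _) _.
apply: ler_sum => l _; rewrite -mulrBr normrM (ger0_norm (ind0 _ _ _)).
rewrite ler_wpM2l//; apply: (hf t (_, _) Dt).
by split; exact: grid_mid_itv.
Qed.

End UpperBound.

(** * Asymptotics of the optimal error *)

Section MidpointError.
Context {R : realType}.
Variables lambda alpha : R.
Hypothesis lambda01 : 0 < lambda < 1.
Hypothesis alpha01 : 0 < alpha <= 1.

Lemma class_error_midpoint_le n (M : R) : (0 < n)%N ->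
  (forall u, period_itv u -> (conv lambda (cell_dev n alpha) u <= M%:E)%E) ->
  (class_error lambda (holder_class alpha) (midpoint_cubature lambda n)
     <= (2 * M)%:E)%E.
Proof.
move=> n0 HM; apply: ge_ereal_sup => _ [f hf <-].
apply: ge_ereal_sup => _ [s Ds <-].
apply: le_trans (remainder_midpoint_le lambda01 alpha01 n0 Ds hf) _.
have [s1 s2] := Ds.
by rewrite mulr_natl mulr2n EFinD leeD// HM.
Qed.

Lemma class_error_midpoint_fin n : (0 < n)%N ->
  class_error lambda (holder_class alpha) (midpoint_cubature lambda n)
    \is a fin_num.
Proof.
move=> n0; rewrite ge0_fin_numE.
  have H u : period_itv u -> (conv lambda (cell_dev n alpha) u <=
      ((pi / n%:R) `^ alpha * gammaK lambda)%:E)%E.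
    apply: (conv_le lambda01); first exact: measurable_cell_dev.
      exact: cell_dev_ge0.
    exact: cell_dev_le.
  by apply: le_lt_trans (class_error_midpoint_le n0 H) _; rewrite ltry.
have a0 : 0 < 1 + alpha by rewrite addr_gt0//; case/andP: alpha01.
apply: le_trans (class_error_ge lambda01 alpha01 _ n0).
rewrite lee_fin mulr_ge0 ?powR_ge0// divr_ge0 ?(ltW a0)// mulr_ge0// ltW//.
exact: gammaK_gt0.
Qed.

End MidpointError.

Unset Implicit Arguments.

Theorem theorem5p5 (R : realType) (lambda alpha : R) :
  0 < lambda < 1 -> 0 < alpha <= 1 ->
  (exists2 eps : nat -> R, eps n @[n --> \oo] --> 0 &
     forall n : nat, (0 < n)%N ->
       class_error lambda (holder_class alpha) (midpoint_cubature lambda n) =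
       ((2 + eps n) * gammaK lambda / (1 + alpha) * (pi / n%:R) `^ alpha)%:E)
  /\ asymptotically_optimal lambda (holder_class alpha)
       (midpoint_cubature lambda).
Proof.
move=> lambda01 alpha01.
have a0 : 0 < 1 + alpha by rewrite addr_gt0//; case/andP: alpha01.
have g0 := gammaK_gt0 lambda01.
pose err n := class_error lambda (holder_class alpha) (midpoint_cubature lambda n).
pose c n := gammaK lambda / (1 + alpha) * (pi / n%:R) `^ alpha.
have c0 n : (0 < n)%N -> 0 < c n.
  move=> n0; apply: mulr_gt0; first exact: divr_gt0.
  by rewrite powR_gt0// divr_gt0 ?pi_gt0 ?ltr0n.
(* the required equation leaves no choice for [eps] *)
pose eps n := fine (err n) / c n - 2.
have errE n : (0 < n)%N -> err n = ((2 + eps n) * c n)%:E.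
  move=> n0; rewrite /eps addrC subrK divfK ?gt_eqF ?c0//.
  by rewrite fineK// class_error_midpoint_fin.
have lower n : (0 < n)%N -> ((2 * c n)%:E <=
    zeta_opt lambda n n 0 0 (holder_class alpha))%E.
  move=> n0; apply: le_trans (zeta_opt_ge lambda01 alpha01 n0).
  by rewrite lee_fin le_eqVlt; apply/orP; left; apply/eqP; rewrite /c; ring.
have upper n : (zeta_opt lambda n n 0 0 (holder_class alpha) <= err n)%E.
  by apply: ereal_inf_lbound; exists (midpoint_cubature lambda n).
have eps0 n : (0 < n)%N -> 0 <= eps n.
  move=> n0; have := le_trans (lower n n0) (upper n).
  by rewrite errE// lee_fin ler_pM2r ?c0// lerDl.
have eps_cvg : eps n @[n --> \oo] --> 0.
  apply/cvgrPdist_le => e e0.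
  pose d := e / 2 * (gammaK lambda / (1 + alpha)).
  have d0 : 0 < d by rewrite mulr_gt0 ?divr_gt0.
  have [N N0 HN] := conv_cell_dev_le lambda01 alpha01 d0.
  exists N => // n /= Nn; have n0 := leq_trans N0 Nn.
  rewrite sub0r normrN ger0_norm ?eps0//.
  have := class_error_midpoint_le lambda01 alpha01 n0 (HN n Nn).
  rewrite -/(err n) errE// lee_fin.
  have -> : 2 * ((gammaK lambda / (1 + alpha) + d) * (pi / n%:R) `^ alpha) =
      (2 + e) * c n by rewrite /d /c; field; exact: lt0r_neq0.
  by rewrite ler_pM2r ?c0// lerD2l.
split.
  exists eps => // n n0; rewrite -/(err n) errE//; congr (_%:E).
  by rewrite /c; ring.
rewrite /asymptotically_optimal.
pose z n := fine (zeta_opt lambda n n 0 0 (holder_class alpha)).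
have zE n : (0 < n)%N -> zeta_opt lambda n n 0 0 (holder_class alpha) = (z n)%:E.
  move=> n0; rewrite fineK// fin_numElt; apply/andP; split.
    by apply: lt_le_trans (lower n n0); rewrite ltNyr.
  by apply: le_lt_trans (upper n) _; rewrite errE// ltry.
have zc n : (0 < n)%N -> 2 * c n <= z n by move=> n0; rewrite -lee_fin -zE// lower.
have z0 n : (0 < n)%N -> 0 < z n.
  by move=> n0; apply: lt_le_trans (zc n n0); rewrite mulr_gt0 ?c0.
pose q n := (2 + eps n) * c n / z n.
have qE n : (0 < n)%N ->
    (class_error lambda (holder_class alpha) (midpoint_cubature lambda n) /
     zeta_opt lambda n n 0 0 (holder_class alpha))%E = (q n)%:E.
  by move=> n0; rewrite -/(err n) errE// zE// inver (gt_eqF (z0 n n0)) -EFinM.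
have q_cvg : q n @[n --> \oo] --> (1 : R).
  apply: (@squeeze_cvgr _ _ _ _ (fun=> 1) (fun n => 1 + eps n / 2)).
  - exists 1%N => // n /= n0; apply/andP; split.
      rewrite ler_pdivlMr ?z0// mul1r -lee_fin -zE// -errE//.
    rewrite ler_pdivrMr ?z0//.
    have e2 : 0 <= 1 + eps n / 2 by rewrite addr_ge0// divr_ge0// eps0.
    apply: le_trans (ler_wpM2l e2 (zc n n0)).
    by rewrite le_eqVlt; apply/orP; left; apply/eqP; field.
  - exact: cvg_cst.
  - rewrite -[X in _ --> X]addr0 -[X in _ + X](mul0r 2^-1).
    by apply: cvgD; [exact: cvg_cst|apply: cvgM => //; exact: cvg_cst].
apply: cvg_EFin.
  by exists 1%N => // n /= n0; rewrite qE.
apply: cvg_trans q_cvg; apply: near_eq_cvg.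
by exists 1%N => // n /= n0; rewrite qE.
Qed.
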